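(* Let $\mathbf{L}\in Q(\mathbb{B}^n)$ and let $F:\mathbb{B}^n\to\mathbb{C}$ be analytic. (Necessity.) If $F$ is of bounded $\mathbf{L}$-index in joint variables, then for every $R\in\mathbb{R}^n_+$ with $|R|\le\beta$ there exist $n_0\in\mathbb{Z}_+$ and $p\ge1$ such that for every $z^0\in\mathbb{B}^n$ there exists $K^0\in\mathbb{Z}^n_+$ with $\|K^0\|\le n_0$ and $$\max\left\{|F^{(K^0)}(z)|:z\in\mathbb{D}^n\left[z^0,R/\mathbf{L}(z^0)\right]\right\}\le p\,|F^{(K^0)}(z^0)|.$$ (Sufficiency.) If for every $R\in\mathbb{R}^n_+$ with $|R|\le\beta$ there exist $n_0\in\mathbb{Z}_+$ and $p\ge1$ such that for every $z^0\in\mathbb{B}^n$ and every $j\in\{1,\dots,n\}$ there exists $K^0_j=(0,\dots,0,k^0_j,0,\dots,0)\in\mathbb{Z}_+^n$ (with $k^0_j$ in the $j$-th place) such that $k^0_j\le n_0$ and $$\max\left\{|F^{(K^0_j)}(z)|:z\in\mathbb{D}^n\left[z^0,R/\mathbf{L}(z^0)\right]\right\}\le p\,|F^{(K^0_j)}(z^0)|,$$ then $F$ is of bounded $\mathbf{L}$-index in joint variables.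
   Context: $\mathbb{R}_+=[0,\infty)$, $\mathbb{Z}_+=\{0,1,2,\dots\}$. $|\cdot|$ is the Euclidean norm on $\mathbb{C}^n$ (and on $\mathbb{R}^n$); $\mathbb{B}^n=\{z\in\mathbb{C}^n:|z|<1\}$. For $K\in\mathbb{Z}^n_+$: $\|K\|=k_1+\dots+k_n$, $K!=k_1!\cdots k_n!$, $A^K=a_1^{k_1}\cdots a_n^{k_n}$, and $F^{(K)}=\partial^{\|K\|}F/\partial z_1^{k_1}\cdots\partial z_n^{k_n}$. Quotients $A/B$ of vectors are componentwise. $\mathbb{D}^n[z^0,R]=\{z:|z_j-z^0_j|\le r_j,\ j=1,\dots,n\}$ for $R=(r_1,\dots,r_n)\in\mathbb{R}^n_+$. Fix a constant $\beta>\sqrt n$. Throughout, $\mathbf{L}(z)=(l_1(z),\dots,l_n(z))$, where each $l_j:\mathbb{B}^n\to\mathbb{R}_+$ is continuous and $l_j(z)>\beta/(1-|z|)$ for all $z\in\mathbb{B}^n$. (Then $\mathbb{D}^n[z^0,R/\mathbf{L}(z^0)]\subset\mathbb{B}^n$ whenever $z^0\in\mathbb{B}^n$, $|R|\le\beta$.) $Q(\mathbb{B}^n)$ is the class of such $\mathbf{L}$ satisfying, for all $R\in\mathbb{R}^n_+$ with $|R|\le\beta$ and all $j$, $0<\lambda_{1,j}(R)\le\lambda_{2,j}(R)<\infty$, where $\lambda_{1,j}(R)$ and $\lambda_{2,j}(R)$ are respectively the infimum and the supremum of $l_j(z)/l_j(z^0)$ over all $z^0\in\mathbb{B}^n$ and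 $z\in\mathbb{D}^n[z^0,R/\mathbf{L}(z^0)]$. An analytic $F:\mathbb{B}^n\to\mathbb{C}$ is of bounded $\mathbf{L}$-index in joint variables if there is $m\in\mathbb{Z}_+$ such that for all $z\in\mathbb{B}^n$ and $J\in\mathbb{Z}^n_+$: $\frac{|F^{(J)}(z)|}{J!\mathbf{L}^J(z)}\le\max\{\frac{|F^{(K)}(z)|}{K!\mathbf{L}^K(z)}:K\in\mathbb{Z}^n_+,\|K\|\le m\}$. *)

(* Defs.v *)
(* MathComp-Analysis: the real field is an arbitrary [R : realType], the complex
   field is [R[i]], and vectors of C^n and R^n are row vectors.  Functions on the
   unit ball are total functions on C^n whose values away from the (open)
   ball are never used. *)
From HB Require Import structures.
From mathcomp Require Export all_boot all_order all_algebra finmap.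
From mathcomp Require Export all_classical all_reals all_analysis.
From mathcomp Require Export complex summability.

Set Implicit Arguments.
Unset Strict Implicit.
Unset Printing Implicit Defensive.

Export Order.TTheory GRing.Theory Num.Theory numFieldNormedType.Exports.

Global Open Scope classical_set_scope.
Global Open Scope ring_scope.
Global Open Scope complex_scope.

(* C as a normed module over itself: the derivatives ['D_v] of functions between
   spaces over [CC R] are limits over complex increments. *)
Notation CC R := (R[i]^o).

Notation cmod := ComplexField.Normc.normc.

(* The library norm on row vectors is the sup norm. *)
Definition euclid_norm (R : realType) (n : nat) (r : 'rV[R]_n) : R :=
  Num.sqrt (\sum_j r 0 j ^+ 2).

Definition cnorm (R : realType) (n : nat) (z : 'rV[CC R]_n) : R :=
  Num.sqrt (\sum_j cmod (z 0 j) ^+ 2).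

Definition unit_ball (R : realType) (n : nat) : set 'rV[CC R]_n :=
  [set z | cnorm z < 1].
Arguments unit_ball : clear implicits.

Definition closed_polydisc (R : realType) (n : nat)
    (z0 : 'rV[CC R]_n) (r : 'rV[R]_n) : set 'rV[CC R]_n :=
  [set z | forall j, cmod (z 0 j - z0 0 j) <= r 0 j].

Definition scaled_radius (R : realType) (n : nat) (r : 'rV[R]_n)
    (L : 'I_n -> 'rV[CC R]_n -> R) (z0 : 'rV[CC R]_n) : 'rV[R]_n :=
  \row_j (r 0 j / L j z0).

Definition admissible_radius (R : realType) (n : nat) (beta : R)
    (r : 'rV[R]_n) : Prop :=
  (forall j, 0 <= r 0 j) /\ euclid_norm r <= beta.

Definition mi_norm (n : nat) (K : 'I_n -> nat) : nat := (\sum_j K j)%N.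

Definition mi_fact (n : nat) (K : 'I_n -> nat) : nat := (\prod_j (K j)`!)%N.

(* F^(K) = d^|K| F / dz_1^{k_1} ... dz_n^{k_n}: the complex derivative in z_n is
   taken first, the one in z_1 last. *)
Definition mderiv (R : realType) (n : nat) (F : 'rV[CC R]_n -> CC R)
    (K : 'I_n -> nat) : 'rV[CC R]_n -> CC R :=
  foldr (fun (j : 'I_n) (G : 'rV[CC R]_n -> CC R) =>
           iter (K j) (fun H : 'rV[CC R]_n -> CC R => 'D_(delta_mx 0 j) H) G)
        F (enum 'I_n).

(* F is, near every point of the unit ball, the sum of a power series in n
   variables; multi-indexed series are summed unconditionally (equivalently,
   absolutely), along the filter of finite sets of multi-indices. *)
Definition analytic_in_ball (R : realType) (n : nat)
    (F : 'rV[CC R]_n -> CC R) : Prop :=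
  forall z0, unit_ball R n z0 ->
  exists (c : {ffun 'I_n -> nat} -> CC R) (rho : R), 0 < rho /\
  forall z : 'rV[CC R]_n, (forall j, cmod (z 0 j - z0 0 j) < rho) ->
    partial_sum (fun K : {ffun 'I_n -> nat} =>
                   c K * \prod_j (z 0 j - z0 0 j) ^+ K j : CC R) @ totally
      --> (F z : CC R).

Definition ratio_set (R : realType) (n : nat) (L : 'I_n -> 'rV[CC R]_n -> R)
    (r : 'rV[R]_n) (j : 'I_n) : set (\bar R) :=
  [set x | exists z0 z, [/\ unit_ball R n z0,
     closed_polydisc z0 (scaled_radius r L z0) z &
     x = (L j z / L j z0)%:E]].

Definition lambda1 (R : realType) (n : nat) (L : 'I_n -> 'rV[CC R]_n -> R)
    (r : 'rV[R]_n) (j : 'I_n) : \bar R := ereal_inf (ratio_set L r j).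

Definition lambda2 (R : realType) (n : nat) (L : 'I_n -> 'rV[CC R]_n -> R)
    (r : 'rV[R]_n) (j : 'I_n) : \bar R := ereal_sup (ratio_set L r j).

(* The class Q(B^n), standing assumptions on L included; L_j >= 0 on the ball
   follows from the lower bound, as beta > 0. *)
Definition class_Q (R : realType) (n : nat) (beta : R)
    (L : 'I_n -> 'rV[CC R]_n -> R) : Prop :=
  [/\ forall j, {within unit_ball R n, continuous (L j)},
      forall j z, unit_ball R n z -> beta / (1 - cnorm z) < L j z
    & forall r, admissible_radius beta r -> forall j,
        [/\ (0 < lambda1 L r j)%E, (lambda1 L r j <= lambda2 L r j)%E
          & (lambda2 L r j < +oo)%E]].

Definition scaled_coef (R : realType) (n : nat) (L : 'I_n -> 'rV[CC R]_n -> R)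
    (F : 'rV[CC R]_n -> CC R) (K : 'I_n -> nat) (z : 'rV[CC R]_n) : R :=
  cmod (mderiv F K z) / ((mi_fact K)%:R * \prod_j L j z ^+ K j).

(* Multi-indices K with |K| <= m have entries in {0, ..., m}; as the quantities
   compared are nonnegative and K = 0 is allowed, the default 0 of the iterated
   maximum is immaterial. *)
Definition bounded_L_index (R : realType) (n : nat)
    (L : 'I_n -> 'rV[CC R]_n -> R) (F : 'rV[CC R]_n -> CC R) : Prop :=
  exists m : nat, forall z, unit_ball R n z -> forall J : 'I_n -> nat,
    scaled_coef L F J z <=
    \big[Num.max/0]_(K : {ffun 'I_n -> 'I_m.+1} | (mi_norm (fun j => K j) <= m)%N)
       scaled_coef L F (fun j => K j) z.

(* The maximum of |G| over a closed polydisc, as an extended real supremum; it is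
   attained when G is continuous there, the polydisc being compact. *)
Definition polydisc_max (R : realType) (n : nat) (G : 'rV[CC R]_n -> CC R)
    (z0 : 'rV[CC R]_n) (r : 'rV[R]_n) : \bar R :=
  ereal_sup [set (cmod (G z))%:E | z in closed_polydisc z0 r].

Definition mi_axis (n : nat) (j : 'I_n) (k : nat) : 'I_n -> nat :=
  fun i => if i == j then k else 0%N.

(* Main.v *)
Require Import Defs.
From mathcomp Require cyclic separable cyclotomic.
From mathcomp Require Import ring lra zify.

Set Implicit Arguments.
Unset Strict Implicit.
Unset Printing Implicit Defensive.

(** Near every point z0 of the ball F is the sum of a power series, which can
    be differentiated term by term ([series_derive], [series_mderiv]). Hence
    F^(J)(z0) = J! c_J ([mderiv_center]): all derivatives of F at z0, in
    whatever order they are taken, are read off one family of coefficients,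
    and the quantity |F^(J)(z0)| / (J! L^J(z0)) is |c_J| / L^J(z0).

    Necessity ([bounded_index_local_growth]). Fix z0 and a point z of the
    polydisc, and let g(t) be the maximum over |K| <= m of |F^(K)| / (K!
    L^K(z0)) at z0 + t (z - z0). The derivative of F^(K) along the segment
    involves derivatives of order |K| + 1 <= m + 1. Bounded index bounds these
    by derivatives of order at most m at the same point, up to the ratios
    L_j(z) / L_j(z0), which are bounded above and below because L is in
    Q(B^n). So g grows at a rate at most C g, where C does not depend on z0
    and z, and g(1) <= e^(C+1) g(0) by a Gronwall argument ([growth]). If K0
    realises the maximum g(0), this says that |F^(K0)(z)| is at most e^(C+1)
    |F^(K0)(z0)|.

    Sufficiency ([axis_bounds_imply_bounded_index]). Apply the hypothesis to R
    = (q, ..., q) with q = beta / sqrt n, a vector of norm beta; here q > 1. A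
    multi-index T of large norm has a component T_j >= n_0 >= k_j, so T = k_j
    e_j + J with J >= 0. Cauchy's inequality for the derivative d_j^{k_j} F on
    the polydisc of radii q / L_i(z0) gives |F^(T)| / (T! L^T) <= p q^(-|J|)
    |F^(k_j e_j)| / (k_j! L_j^{k_j}) at z0, and p q^(-|J|) <= 1 as soon as |J|
    is large ([axis_dominates]).

    Cauchy's inequality ([cauchy_polydisc]) is obtained without integration.
    Averaging zeta |-> G(z0 + zeta (r_j w^(e_j))_j) against w^(- e.J), where w
    is a primitive root of unity of large order and e runs over all tuples of
    exponents, gives a function of one variable equal to c_J r^J zeta^|J| up
    to O(zeta^(|J|+3)). After division by zeta^|J| the maximum principle on
    the unit disc bounds |c_J| r^J ([cauchy_coef]). The maximum principle in
    turn needs only local Taylor expansions of order three: the mean over z +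
    x, z + ix, z - x, z - ix shows that Re(conj(a) h) + e |z|^2 has no
    interior maximum ([max_principle]). *)

(** * Modulus and unconditional sums of complex numbers *)

Section ComplexSums.
Context (R : realType).

Implicit Types (x y : R[i]).

Lemma cmodE x : `|x| = (cmod x)%:C.
Proof. by []. Qed.

Lemma cmod_ge0 x : 0 <= cmod x.
Proof. by case: x => a b; exact: sqrtr_ge0. Qed.

Lemma cmodD x y : cmod (x + y) <= cmod x + cmod y.
Proof. exact: le_normcD. Qed.

Lemma cmodN x : cmod (- x) = cmod x.
Proof. exact: normcN. Qed.

Lemma cmodB x y : cmod (x - y) <= cmod x + cmod y.
Proof. by rewrite -(cmodN y); exact: cmodD. Qed.

Lemma cmod_distC x y : cmod (x - y) = cmod (y - x).
Proof. by rewrite -cmodN opprB. Qed.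

Lemma cmod0 : cmod (0 : R[i]) = 0.
Proof. exact: Normc.normc0. Qed.

Lemma cmod1 : cmod (1 : R[i]) = 1.
Proof. exact: Normc.normc1. Qed.

Lemma cmodM x y : cmod (x * y) = cmod x * cmod y.
Proof. exact: Normc.normcM. Qed.

Lemma cmodV x : cmod x^-1 = (cmod x)^-1.
Proof. exact: Normc.normcV. Qed.

Lemma cmodX x n : cmod (x ^+ n) = cmod x ^+ n.
Proof. by elim: n => [|n IH]; rewrite ?cmod1 // !exprS cmodM IH. Qed.

Lemma cmod_eq0 x : (cmod x == 0) = (x == 0).
Proof. by apply/eqP/eqP => [/Normc.eq0_normc//|->]; exact: cmod0. Qed.

Lemma cmod_gt0 x : (0 < cmod x) = (x != 0).
Proof. by rewrite lt_def cmod_ge0 andbT cmod_eq0. Qed.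

Lemma cmod_real (a : R) : cmod a%:C = `|a|.
Proof. by rewrite /= expr0n addr0 sqrtr_sqr. Qed.

Lemma cmod_nat n : cmod (n%:R : R[i]) = n%:R.
Proof. by rewrite -(rmorph_nat (real_complex R)) cmod_real ger0_norm. Qed.

Lemma cmod_prod (I : Type) (s : seq I) (P : pred I) (f : I -> R[i]) :
  cmod (\prod_(i <- s | P i) f i) = \prod_(i <- s | P i) cmod (f i).
Proof. exact: (big_morph (@cmod R) cmodM cmod1). Qed.

Lemma cmod_sum (I : Type) (s : seq I) (P : pred I) (f : I -> R[i]) :
  cmod (\sum_(i <- s | P i) f i) <= \sum_(i <- s | P i) cmod (f i).
Proof.
elim/big_rec2: _ => [|i a b _ h]; first by rewrite cmod0.
by rewrite (le_trans (cmodD _ _)) // lerD2l.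
Qed.

Lemma Re_le_cmod x : `|complex.Re x| <= cmod x.
Proof. by rewrite -lecR; exact: normc_ge_Re. Qed.

Lemma cmod_le_ReIm x : cmod x <= `|complex.Re x| + `|complex.Im x|.
Proof.
rewrite {1}(complexE x) (le_trans (cmodD _ _)) // cmodM !cmod_real.
by rewrite /= expr0n add0r expr1n sqrtr1 mul1r.
Qed.

Lemma ReD x y : complex.Re (x + y) = complex.Re x + complex.Re y.
Proof. by case: x; case: y. Qed.

Lemma Re_mulNi x : complex.Re (- 'i%C * x) = complex.Im x.
Proof. by case: x => a b /=; rewrite oppr0 mul0r sub0r mulN1r opprK. Qed.

Lemma Im_le_cmod x : `|complex.Im x| <= cmod x.
Proof.
rewrite -Re_mulNi (le_trans (Re_le_cmod _)) // cmodM cmodN.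
by rewrite /= expr0n add0r expr1n sqrtr1 mul1r.
Qed.

Lemma Re_sum (I : Type) (s : seq I) (P : pred I) (f : I -> R[i]) :
  complex.Re (\sum_(i <- s | P i) f i) = \sum_(i <- s | P i) complex.Re (f i).
Proof. exact: (big_morph (@complex.Re R) ReD (erefl _)). Qed.

Lemma ImD x y : complex.Im (x + y) = complex.Im x + complex.Im y.
Proof. by case: x; case: y. Qed.

Lemma Im_sum (I : Type) (s : seq I) (P : pred I) (f : I -> R[i]) :
  complex.Im (\sum_(i <- s | P i) f i) = \sum_(i <- s | P i) complex.Im (f i).
Proof. exact: (big_morph (@complex.Im R) ImD (erefl _)). Qed.

Section Sums.
Context (I : choiceType).
Implicit Types (f g : I -> R[i]) (A B : {fset I}).
Local Open Scope fset_scope.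
Local Open Scope ring_scope.

(** The tolerance is real: the norm on the complex field takes complex values,
    whose order is not total. *)
Definition sums_to f (S : R[i]) := forall e : R, 0 < e ->
  exists A0, forall A, A0 `<=` A -> cmod (\sum_(i <- A) f i - S) <= e.

Definition abs_bounded f (B : R) := forall A, \sum_(i <- A) cmod (f i) <= B.

Lemma sums_to_le f S (b : R) : sums_to f S -> abs_bounded f b -> cmod S <= b.
Proof.
move=> fS fb; apply/ler_addgt0Pr => e /fS[A0 /(_ A0)].
move=> /(_ (fsubset_refl _)); set s := \sum_(i <- A0) _ => h.
rewrite (_ : S = s - (s - S)); last by ring.
rewrite (le_trans (cmodB _ _)) // lerD // (le_trans _ (fb A0)) //.
exact: cmod_sum.
Qed.

Lemma sums_toD f g S T : sums_to f S -> sums_to g T ->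
  sums_to (fun i => f i + g i) (S + T).
Proof.
move=> fS gT e e0; have e2 : 0 < e / 2 by rewrite divr_gt0.
have [A1 h1] := fS _ e2; have [A2 h2] := gT _ e2.
exists (A1 `|` A2) => A; rewrite fsubUset => /andP[/h1 {}h1 /h2 {}h2].
rewrite big_split /= opprD addrACA (le_trans (cmodD _ _)) //.
by rewrite [e]splitr lerD.
Qed.

Lemma sums_toZ f S a : sums_to f S -> sums_to (fun i => a * f i) (a * S).
Proof.
move=> fS e e0; have a1 : 0 < cmod a + 1 by rewrite ltr_wpDl // cmod_ge0.
have [|A0 h] := fS (e / (cmod a + 1)); first by rewrite divr_gt0.
exists A0 => A /h {}h; rewrite -mulr_sumr -mulrBr cmodM.
rewrite (le_trans (ler_wpM2l (cmod_ge0 _) h)) // mulrCA ger_pMr //.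
by rewrite ler_pdivrMr // mul1r lerDl.
Qed.

Lemma sums_to0 : sums_to (fun=> 0) 0.
Proof.
move=> e e0; exists fset0 => A _.
by rewrite big1 ?subrr ?cmod0 ?ltW.
Qed.

Lemma eq_sums_to f g S : f =1 g -> sums_to f S -> sums_to g S.
Proof.
move=> fg fS e /fS[A0 h]; exists A0 => A /h.
by rewrite (eq_bigr g).
Qed.

Lemma sums_toN f S : sums_to f S -> sums_to (fun i => - f i) (- S).
Proof.
move=> /(sums_toZ (-1)); rewrite mulN1r; apply: eq_sums_to => i.
by rewrite mulN1r.
Qed.

Lemma sums_toB f g S T : sums_to f S -> sums_to g T ->
  sums_to (fun i => f i - g i) (S - T).
Proof. by move=> fS /sums_toN; exact: sums_toD. Qed.

Lemma sums_to_sum (J : Type) (s : seq J) (f : J -> I -> R[i]) (S : J -> R[i]) :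
  (forall j, sums_to (f j) (S j)) ->
  sums_to (fun i => \sum_(j <- s) f j i) (\sum_(j <- s) S j).
Proof.
move=> fS; elim: s => [|j s IH].
  by rewrite big_nil; apply: eq_sums_to sums_to0 => i; rewrite big_nil.
rewrite big_cons; apply: eq_sums_to (sums_toD (fS j) IH) => i.
by rewrite big_cons.
Qed.

Lemma sums_to_unique f S T : sums_to f S -> sums_to f T -> S = T.
Proof.
move=> fS fT; apply/eqP; rewrite -subr_eq0 -cmod_eq0 eq_le cmod_ge0 andbT.
apply: (@sums_to_le (fun i => f i - f i)); first exact: sums_toB.
by move=> A; rewrite big1 // => i _; rewrite subrr cmod0.
Qed.

(** A family with finite support is summed by its support; this is how a value
    is read off a series at its centre, or off a homogeneous part of a series. *)
Lemma sums_to_finite f A0 : (forall i, i \notin A0 -> f i = 0) ->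
  sums_to f (\sum_(i <- A0) f i).
Proof.
move=> f0 e e0; exists A0 => A sA.
rewrite -(big_fset_incl _ sA) ?subrr ?cmod0 ?ltW // => i _.
exact: f0.
Qed.

(** The sum is the supremum of the finite partial sums. *)
Lemma sup_sums_to (f : I -> R) (b : R) : (forall i, 0 <= f i) ->
  (forall A, \sum_(i <- A) f i <= b) ->
  exists S, sums_to (fun i => (f i)%:C) S.
Proof.
move=> f0 fb; pose E := [set \sum_(i <- A) f i | A in @setT {fset I}].
have supE : has_sup E.
  split; first by exists (\sum_(i <- fset0) f i), fset0.
  by exists b => _ [A _ <-].
exists (sup E)%:C => e e0.
have [_ [A0 _ <-] hA0] := sup_adherent e0 supE.
exists A0 => A sA; rewrite -rmorph_sum -rmorphB cmod_real distrC.
have le1 : \sum_(i <- A) f i <= sup E by apply: sup_upper_bound => //; exists A.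
rewrite ger0_norm ?subr_ge0 // lerBlDr -lerBlDl (le_trans (ltW hA0)) //.
rewrite [leRHS](big_fsetID _ (mem A0)) /=.
have -> : [fset x in A | x \in A0] = A0.
  by apply/fsetP => i; rewrite !inE /= andb_idl // => /(fsubsetP sA).
by rewrite lerDl sumr_ge0.
Qed.

(** Completeness. A real family [g] is the difference of the nonnegative
    families [|g| + g] and [|g|], and a complex one is handled through its
    real and imaginary parts. *)
Lemma abs_bounded_sums_to f (b : R) : abs_bounded f b -> exists S, sums_to f S.
Proof.
move=> fb.
have H (g : I -> R) : (forall i, `|g i| <= cmod (f i)) ->
    exists S, sums_to (fun i => (g i)%:C) S.
  move=> gf.
  have gb A : \sum_(i <- A) `|g i| <= b.
    by apply: le_trans (fb A); apply: ler_sum.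
  have [|//|S hS] := @sup_sums_to (fun i => `|g i|) b; first by [].
  have [||T hT] := @sup_sums_to (fun i => `|g i| + g i) (b + b).
  - by move=> i; have := ler_norm (- g i); rewrite normrN; lra.
  - move=> A; rewrite big_split lerD //= (le_trans _ (gb A)) //.
    by apply: ler_sum => i _; exact: ler_norm.
  exists (T - S); apply: eq_sums_to (sums_toB hT hS) => i.
  by rewrite -rmorphB addrC addKr.
have [S hS] := H (fun i => complex.Re (f i)) (fun i => Re_le_cmod _).
have [T hT] := H (fun i => complex.Im (f i)) (fun i => Im_le_cmod _).
exists (S + 'i%C * T); apply: eq_sums_to (sums_toD hS (sums_toZ _ hT)) => i.
by rewrite -complexE.
Qed.

(** Sum the nonnegative terms and the negative terms separately: in each group
    the modulus of the sum is the sum of the moduli. *)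
Lemma real_sum_bounded (g : I -> R) (c : R) :
  (forall B, `|\sum_(i <- B) g i| <= c) -> forall B, \sum_(i <- B) `|g i| <= c + c.
Proof.
move=> gc B; rewrite (big_fsetID _ (fun i => 0 <= g i)) /=; apply: lerD.
  apply: le_trans (gc [fset x in B | 0 <= g x]); apply: le_trans (ler_norm _).
  rewrite le_eqVlt; apply/orP; left; apply/eqP; apply: eq_big_seq => i.
  by rewrite !inE /= => /andP[_ ?]; rewrite ger0_norm.
apply: le_trans (gc [fset x in B | ~~ (0 <= g x)]); rewrite -normrN.
apply: le_trans (ler_norm _).
rewrite -sumrN le_eqVlt; apply/orP; left; apply/eqP; apply: eq_big_seq => i.
by rewrite !inE /= => /andP[_ ?]; rewrite ltr0_norm // ltNge.
Qed.

(** Unconditional convergence is absolute convergence. Once [A0] captures the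
    sum up to 1, finite sums away from [A0] are bounded by 2, so all finite
    sums of the family are bounded, and [real_sum_bounded] applies to the real
    and to the imaginary parts. *)
Lemma sums_to_abs_bounded f S : sums_to f S -> exists b, abs_bounded f b.
Proof.
move=> /(_ 1 ltr01)[A0 hA0].
have part B : cmod (\sum_(i <- B) f i) <= \sum_(i <- A0) cmod (f i) + 2.
  rewrite (big_fsetID _ (mem A0)) /= (le_trans (cmodD _ _)) //; apply: lerD.
    rewrite (le_trans (cmod_sum _ _ _)) //.
    rewrite [leRHS](big_fsetID _ (mem B)) /=.
    have -> : [fset x in A0 | x \in B] = [fset x in B | x \in A0].
      by apply/fsetP => i; rewrite !inE /= andbC.
    by rewrite lerDl sumr_ge0 // => i _; exact: cmod_ge0.
  set B' := [fset x in B | x \notin A0].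
  have := hA0 (A0 `|` B') (fsubsetUl _ _).
  rewrite (big_fsetID _ (mem A0)) /=.
  have -> : [fset x in A0 `|` B' | x \in A0] = A0.
    by apply/fsetP => i; rewrite !inE /= andbC; case: (i \in A0) => //=.
  have -> : [fset x in A0 `|` B' | x \notin A0] = B'.
    by apply/fsetP => i; rewrite !inE /=; case: (i \in A0); rewrite ?andbF ?andbT.
  have := hA0 A0 (fsubset_refl _).
  set a := \sum_(i <- A0) _; set s := \sum_(i <- B') _ => h1 h2.
  rewrite (_ : s = (a + s - S) - (a - S)); last by ring.
  by rewrite (le_trans (cmodB _ _)) // (_ : 2 = 1 + 1) // lerD.
set c := \sum_(i <- A0) _ + 2 in part.
exists ((c + c) + (c + c)) => B.
apply: le_trans (_ : \sum_(i <- B) (`|complex.Re (f i)| + `|complex.Im (f i)|) <= _).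
  by apply: ler_sum => i _; exact: cmod_le_ReIm.
rewrite big_split /=; apply: lerD; apply: real_sum_bounded => D.
  by rewrite -Re_sum (le_trans (Re_le_cmod _)).
by rewrite -Im_sum (le_trans (Im_le_cmod _)).
Qed.

End Sums.

(** Serves for the shift of exponents caused by differentiation. *)
Lemma sums_to_reindex (I J : choiceType) (phi : I -> J) (f : J -> R[i]) S :
  injective phi -> (forall j, (forall i, phi i != j) -> f j = 0) ->
  sums_to f S -> sums_to (f \o phi) S.
Proof.
move=> phiI f0 fS e /fS[A0 hA0].
(* [psi] is a partial inverse of [phi]. *)
have /choice[psi psiP] : forall j, exists o : option I,
    forall i, phi i = j -> o = Some i.
  move=> j; case: (pselect (exists i, phi i = j)) => [[i <-]|h].
    by exists (Some i) => i' /phiI ->.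
  by exists None => i hi; case: h; exists i.
pose P0 : {fset I} := [fset i in pmap psi A0]%fset.
exists P0 => A sA.
have imP j : j \in (phi @` A)%fset <-> exists2 i, i \in A & phi i = j.
  split=> [/imfsetP[i /= iA ->]|[i iA <-]]; first by exists i.
  by apply/imfsetP; exists i.
have -> : \sum_(i <- A) (f \o phi) i = \sum_(j <- (A0 `|` phi @` A)%fset) f j.
  rewrite -(big_fset_incl _ (fsubsetUr A0 (phi @` A)%fset)); last first.
    move=> j; rewrite inE => /orP[jA0|->//] jA; apply: f0 => i.
    apply/eqP => ij; move/negP: jA; apply; apply/imP; exists i => //.
    apply: (fsubsetP sA); rewrite !inE /= mem_pmap.
    by apply/mapP; exists j => //; rewrite (psiP _ _ ij).
  by rewrite big_imfset //= => i i' _ _; exact: phiI.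
exact/hA0/fsubsetUl.
Qed.

End ComplexSums.

(** * Power series in several variables *)

Section PowerSeriesTheory.
Context (R : realType).

Lemma cvg_sums_to (I : choiceType) (f : I -> CC R) (S : CC R) :
  partial_sum f @ totally --> S -> sums_to f S.
Proof.
have FT : Filter (@totally I) by have PF := @totally_filter I; exact: _.
move=> /cvgrPdist_le fS e e0.
have e0' : 0 < e%:C :> R[i] by rewrite ltcR.
have [A0 _ hA0] := fS _ e0'.
exists A0 => A /hA0; rewrite /= /partial_sum -(big_seq_fsetE _ A xpredT f).
by rewrite cmodE lecR cmod_distC.
Qed.

Lemma derive_eps (V : normedModType R[i]) (F : V -> CC R) z v (D : R[i]) :
  (forall e : R, 0 < e -> exists2 d : R, 0 < d & forall h : R[i], h != 0 ->
     cmod h <= d -> cmod ((F (z + h *: v) - F z) / h - D) <= e) ->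
  'D_v F z = D.
Proof.
move=> H; apply: cvg_lim; first exact: norm_hausdorff.
apply/cvgrPdist_le => e e0.
have [er ee] : exists er : R, e = er%:C.
  by case: e e0 => a b; rewrite ltcE /= => /andP[/eqP -> _]; exists a.
move: e0; rewrite ee ltcR => /H[d d0 hd]; near=> h.
rewrite cmodE lecR cmod_distC /= [h *: v + z]addrC.
rewrite -[h^-1 *: _]/(h^-1 * _ : R[i]) (mulrC h^-1).
apply: hd; first by near: h; exact: nbhs_dnbhs_neq.
rewrite -lecR -cmodE; near: h; apply: dnbhs0_le; by rewrite ltcR.
Unshelve. all: by end_near. Qed.

(** Second-order Taylor remainder of the k-th power at [u]. *)
Definition pow_remainder (A : comNzRingType) (u h : A) (k : nat) : A :=
  (u + h) ^+ k - u ^+ k - k%:R * u ^+ k.-1 * h.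

Lemma pow_remainderS (A : comNzRingType) (u h : A) k :
  pow_remainder u h k.+1 =
    (u + h) * pow_remainder u h k + k%:R * u ^+ k.-1 * h ^+ 2.
Proof.
by rewrite /pow_remainder; case: k => [|k] /=; rewrite ?exprS -?natr1; ring.
Qed.

(** As a polynomial in u and h the remainder has nonnegative coefficients and
    is divisible by h^2. It is therefore majorised by its value at the moduli,
    and its quotient by h^2 does not decrease when |h| is replaced by [d]. *)
Lemma pow_remainder_le (u h : R[i]) (d : R) k : cmod h <= d ->
  cmod (pow_remainder u h k) * d ^+ 2
    <= cmod h ^+ 2 * pow_remainder (cmod u) d k.
Proof.
move=> hd; have h0 := cmod_ge0 h; have u0 := cmod_ge0 u.
have d0 : 0 <= d by apply: le_trans hd.
elim: k => [|k IH].
  by rewrite /pow_remainder !expr0 !mul0r !subrr cmod0 mul0r mulr0.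
rewrite !pow_remainderS.
apply: le_trans (ler_wpM2r (sqr_ge0 _) (cmodD _ _)) _.
rewrite [(_ + _) * d ^+ 2]mulrDl [cmod h ^+ 2 * _]mulrDr; apply: lerD.
  rewrite cmodM -mulrA [leRHS]mulrCA.
  apply: ler_pM => //; rewrite ?cmod_ge0 ?mulr_ge0 ?cmod_ge0 ?sqr_ge0 //.
  by rewrite (le_trans (cmodD _ _)) // lerD2l.
by rewrite !cmodM !cmodX cmod_nat [leLHS]mulrAC [leRHS]mulrC.
Qed.

Lemma pow_remainder_ge0 (a d : R) k : 0 <= a -> 0 < d -> 0 <= pow_remainder a d k.
Proof.
move=> a0 d0; have := @pow_remainder_le a%:C d%:C d k.
rewrite !cmod_real !ger0_norm ?(ltW d0) // => /(_ (lexx _)).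
rewrite [leRHS]mulrC ler_pM2r ?exprn_gt0 //; apply: le_trans; exact: cmod_ge0.
Qed.

(** [k a^(k-1) d] is one of the nonnegative terms in the expansion of [(a +
    d)^k]: a derived series is dominated by the original one at a slightly
    larger radius. *)
Lemma dpow_le (u : R[i]) (d : R) k : 0 < d ->
  cmod (k%:R * u ^+ k.-1) <= d^-1 * (cmod u + d) ^+ k.
Proof.
move=> d0; have := pow_remainder_ge0 k (cmod_ge0 u) d0.
rewrite cmodM cmodX cmod_nat ler_pdivlMl // /pow_remainder.
have := exprn_ge0 k (cmod_ge0 u); lra.
Qed.

(** The error of the difference quotient is dominated by the original power at
    a slightly larger radius, with a factor that is linear in |h|; summed over
    the terms of a power series this gives termwise differentiation. *)
Lemma dquot_le (u h : R[i]) (d : R) k : 0 < d -> h != 0 -> cmod h <= d ->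
  cmod (((u + h) ^+ k - u ^+ k) / h - k%:R * u ^+ k.-1)
    <= cmod h / d ^+ 2 * (cmod u + d) ^+ k.
Proof.
move=> d0 h0 hd; have := pow_remainder_le u k hd.
have -> : ((u + h) ^+ k - u ^+ k) / h - k%:R * u ^+ k.-1 = pow_remainder u h k / h.
  by rewrite /pow_remainder; field.
have hp : 0 < cmod h by rewrite cmod_gt0.
rewrite cmodM cmodV -ler_pdivlMr ?exprn_gt0 // => H.
rewrite ler_pdivrMr // (le_trans H) //.
have -> : cmod h / d ^+ 2 * (cmod u + d) ^+ k * cmod h =
    cmod h ^+ 2 * (cmod u + d) ^+ k / d ^+ 2.
  by field; apply: lt0r_neq0.
rewrite ler_pM2r ?invr_gt0 ?exprn_gt0 // ler_wpM2l ?exprn_ge0 ?cmod_ge0 //.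
have := mulr_ge0 (mulr_ge0 (ler0n R k) (exprn_ge0 k.-1 (cmod_ge0 u))) (ltW d0).
have := exprn_ge0 k (cmod_ge0 u); rewrite /pow_remainder; lra.
Qed.

Section PowerSeries.
Context (n : nat).
Implicit Types (F : 'rV[CC R]_n -> CC R) (z : 'rV[CC R]_n) (j : 'I_n).
Implicit Types (c : {ffun 'I_n -> nat} -> R[i]) (K : {ffun 'I_n -> nat}).

Definition has_series F z0 c (rho : R) := 0 < rho /\
  forall z, (forall j, cmod (z 0 j - z0 0 j) < rho) ->
    sums_to (fun K => c K * \prod_j (z 0 j - z0 0 j) ^+ K j) (F z).

Definition mi_succ j K : {ffun 'I_n -> nat} := [ffun i => (K i + (i == j))%N].

Definition dcoef j c K : R[i] := (K j).+1%:R * c (mi_succ j K).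

(** At the point z0 + s with real nonnegative s_j < rho the moduli of the
    terms are [|c_K| s^K]. *)
Lemma series_abs_bounded F z0 c rho (s : 'I_n -> R) :
  has_series F z0 c rho -> (forall j, 0 <= s j < rho) ->
  exists b, forall A : {fset {ffun 'I_n -> nat}},
    \sum_(K <- A) cmod (c K) * \prod_j s j ^+ K j <= b.
Proof.
move=> [rho0 Fc] hs.
pose z : 'rV[CC R]_n := \row_j (z0 0 j + (s j)%:C).
have zE j : z 0 j - z0 0 j = (s j)%:C by rewrite mxE addrC addKr.
have sj j : cmod (s j)%:C = s j by rewrite cmod_real ger0_norm //; case/andP: (hs j).
have [|b hb] := sums_to_abs_bounded (Fc z _).
  by move=> j; rewrite zE sj; case/andP: (hs j).
exists b => A; apply: le_trans (hb A).
rewrite le_eqVlt; apply/orP; left; apply/eqP; apply: eq_bigr => K _.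
rewrite cmodM cmod_prod; congr (_ * _); apply: eq_bigr => j _.
by rewrite cmodX zE sj.
Qed.

(** Termwise differentiation, with the same polyradius. At a point z0 + u
    enlarge the j-th radius from |u_j| to |u_j| + d < rho. By [dquot_le] the
    difference quotient differs from the derived series by at most |h| d^-2
    times the sum of the [|c_K| s^K] at the enlarged radii, which is finite. *)
Lemma series_derive F z0 c rho j :
  has_series F z0 c rho -> has_series ('D_(delta_mx 0 j) F) z0 (dcoef j c) rho.
Proof.
move=> Fc; have [rho0 Fs] := Fc; split=> // z hz.
pose u i : R[i] := z 0 i - z0 0 i.
pose d := (rho - cmod (u j)) / 2.
have d0 : 0 < d by rewrite divr_gt0 // subr_gt0 hz.
have ud : cmod (u j) + d < rho by have := hz j; rewrite /d -/(u j); lra.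
pose s i := cmod (u i) + (if i == j then d else 0).
have [|b hb] := @series_abs_bounded _ _ _ _ s Fc.
  move=> i; rewrite /s addr_ge0 ?cmod_ge0 //=; last by case: eqP => _ //; apply: ltW.
  by case: eqP => [->//|_]; rewrite addr0; apply: hz.
pose rest K := \prod_(i | i != j) u i ^+ K i.
have restE K : \prod_i s i ^+ K i = (cmod (u j) + d) ^+ K j * cmod (rest K).
  rewrite (bigD1 j) //= {1}/s eqxx cmod_prod; congr (_ * _).
  by apply: eq_bigr => i /negPf ij; rewrite /s ij addr0 cmodX.
have monoE (w : R[i]) K :
    \prod_i (u i + (if i == j then w else 0)) ^+ K i = (u j + w) ^+ K j * rest K.
  rewrite (bigD1 j) //= eqxx; congr (_ * _).
  by apply: eq_bigr => i /negPf ij; rewrite ij addr0.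
pose fD K := c K * ((K j)%:R * u j ^+ (K j).-1 * rest K).
have bound_ext (f : {ffun 'I_n -> nat} -> R[i]) (a : R) : 0 <= a ->
    (forall K, cmod (f K) <=
       a * (cmod (c K) * ((cmod (u j) + d) ^+ K j * cmod (rest K)))) ->
    abs_bounded f (a * b).
  move=> a0 fle A; apply: le_trans (ler_wpM2l a0 (hb A)).
  by rewrite mulr_sumr; apply: ler_sum => K _; rewrite restE.
have fDb : abs_bounded fD (d^-1 * b).
  apply: bound_ext => [|K]; first by rewrite invr_ge0 ltW.
  rewrite /fD cmodM mulrCA ler_wpM2l ?cmod_ge0 // cmodM mulrA.
  by rewrite ler_wpM2r ?cmod_ge0 // dpow_le.
have [D hD] := abs_bounded_sums_to fDb.
have b0 : 0 <= b by have := hb fset0; rewrite big_seq_fset0.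
have -> : 'D_(delta_mx 0 j) F z = D.
  apply: derive_eps => e e0.
  have a0 : 0 < b / d ^+ 2 + 1 by rewrite ltr_wpDl // divr_ge0 // exprn_ge0 // ltW.
  exists (Num.min d (e / (b / d ^+ 2 + 1))).
    by rewrite lt_min d0 divr_gt0.
  move=> h h0; rewrite le_min => /andP[hd he].
  have shift i : (z + h *: delta_mx 0 j) 0 i - z0 0 i
      = u i + (if i == j then h else 0).
    rewrite !mxE eqxx /= /u addrAC; congr (_ + _).
    by case: eqP => _; rewrite /GRing.scale /= ?mulr1 ?mulr0.
  have S1 : sums_to (fun K => c K * ((u j + h) ^+ K j * rest K))
      (F (z + h *: delta_mx 0 j)).
    have hzh i : cmod ((z + h *: delta_mx 0 j) 0 i - z0 0 i) < rho.
      rewrite shift; case: eqP => [->|_]; last by rewrite addr0; exact: hz.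
      by rewrite (le_lt_trans (cmodD _ _)) // (le_lt_trans _ ud) // lerD2l.
    apply: eq_sums_to (Fs _ hzh) => K; rewrite -monoE; congr (_ * _).
    by apply: eq_bigr => i _; rewrite shift.
  have S2 : sums_to (fun K => c K * (u j ^+ K j * rest K)) (F z).
    apply: eq_sums_to (Fs _ hz) => K; congr (_ * _).
    by rewrite (bigD1 j).
  have S3 := sums_toB (sums_toZ h^-1 (sums_toB S1 S2)) hD.
  rewrite mulrC; apply: le_trans (sums_to_le S3 (b := cmod h / d ^+ 2 * b) _) _.
    apply: bound_ext => [|K].
      by rewrite divr_ge0 ?cmod_ge0 // exprn_ge0 // ltW.
    have -> : h^-1 * (c K * ((u j + h) ^+ K j * rest K) -
                      c K * (u j ^+ K j * rest K)) - fD K =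
        c K * ((((u j + h) ^+ K j - u j ^+ K j) / h -
               (K j)%:R * u j ^+ (K j).-1) * rest K).
      by rewrite /fD; ring.
    rewrite cmodM mulrCA ler_wpM2l ?cmod_ge0 // cmodM mulrA.
    by rewrite ler_wpM2r ?cmod_ge0 // dquot_le.
  rewrite ler_pdivlMr // in he; apply: le_trans he.
  rewrite -mulrA ler_wpM2l ?cmod_ge0 // mulrC; lra.
(* What remains is the shift K |-> K + e_j; the terms with K_j = 0, off its
   image, have derivative zero. *)
have succI : injective (mi_succ j).
  move=> K K' /ffunP eK; apply/ffunP => i; have := eK i.
  by rewrite !ffunE => /addIn.
apply: eq_sums_to (sums_to_reindex succI _ hD) => [K|K nK].
  rewrite /= /fD /dcoef !ffunE eqxx addn1 /=.
  rewrite (bigD1 j) //= -/(u j).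
  have -> : rest (mi_succ j K) = \prod_(i | i != j) (z 0 i - z0 0 i) ^+ K i.
    by apply: eq_bigr => i /negPf ij; rewrite ffunE ij addn0.
  by ring.
case Kj: (K j) => [|k]; first by rewrite /fD Kj !mul0r mulr0.
have := nK [ffun i => if i == j then k else K i] => /eqP[].
apply/ffunP => i; rewrite !ffunE; case: eqP => [->|_]; first by rewrite Kj addn1.
by rewrite addn0.
Qed.

Lemma series_center F z0 c rho : has_series F z0 c rho -> F z0 = c [ffun=> 0%N].
Proof.
move=> [rho0 /(_ z0) Fs].
have {}Fs := Fs (fun j => _); apply: sums_to_unique (Fs _) _.
  by move=> j; rewrite subrr cmod0.
set f := fun K => _.
have -> : c [ffun=> 0%N] = \sum_(K <- [fset [ffun=> 0%N]]%fset) f K.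
  rewrite big_seq_fset1 /f big1 ?mulr1 // => j _.
  by rewrite ffunE expr0.
apply: sums_to_finite => K; rewrite inE => K0.
suff [j Kj] : exists j, K j != 0%N.
  by rewrite /f (bigD1 j) //= subrr expr0n (negPf Kj) mul0r mulr0.
apply/existsP; apply: contraNT K0; rewrite negb_exists => /forallP K0.
by apply/eqP/ffunP => j; rewrite ffunE; apply/eqP; have := K0 j; rewrite negbK.
Qed.

Lemma series_iter_derive F z0 c rho j k : has_series F z0 c rho ->
  has_series (iter k (fun H : 'rV[CC R]_n -> CC R => 'D_(delta_mx 0 j) H) F) z0
    (fun K => ((K j + k) ^_ k)%:R * c [ffun i => (K i + (i == j) * k)%N]) rho.
Proof.
move=> Fc; elim: k => [|k IH] /=.
  case: Fc => r0 Fs; split=> // z /Fs; apply: eq_sums_to => K.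
  rewrite ffactn0 mul1r; congr (c _ * _).
  by apply/ffunP => i; rewrite ffunE muln0 addn0.
have [r0 Fs] := series_derive j IH; split=> // z /Fs; apply: eq_sums_to => K.
rewrite /dcoef ffunE eqxx addn1 mulrA -natrM; congr (_%:R * c _ * _).
  by rewrite addnS ffactnSr addSn mulnC subSn ?leq_addl // addnK.
by apply/ffunP => i; rewrite !ffunE; case: eqP => _; rewrite ?mul1n ?mul0n ?addn0 // addn1 addSnnS.
Qed.

(** Since the coefficients of a mixed derivative are given in closed form from
    those of [F], the order of differentiation disappears. *)
Lemma series_mderiv F z0 c rho (J : 'I_n -> nat) : has_series F z0 c rho ->
  has_series (mderiv F J) z0
    (fun K => (\prod_i (K i + J i) ^_ (J i))%:R * c [ffun i => (K i + J i)%N]) rho.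
Proof.
move=> Fc; rewrite /mderiv.
suff H s : uniq s -> has_series (foldr (fun (j : 'I_n) (G : 'rV[CC R]_n -> CC R) =>
           iter (J j) (fun H : 'rV[CC R]_n -> CC R => 'D_(delta_mx 0 j) H) G)
        F s) z0 (fun K => (\prod_(i <- s) (K i + J i) ^_ (J i))%:R *
           c [ffun i => (K i + (i \in s) * J i)%N]) rho.
  have [r0 Fs] := H _ (enum_uniq 'I_n); split=> // z /Fs; apply: eq_sums_to => K.
  rewrite big_enum /=; congr (_ * c _ * _).
  by apply/ffunP => i; rewrite !ffunE mem_enum mul1n.
elim: s => [_|j s IH /andP[js us]] /=.
  case: Fc => r0 Fs; split=> // z /Fs; apply: eq_sums_to => K.
  rewrite big_nil mul1r; congr (c _ * _).
  by apply/ffunP => i; rewrite ffunE mul0n addn0.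
have [r0 Fs] := series_iter_derive j (J j) (IH us).
split=> // z /Fs; apply: eq_sums_to => K.
rewrite mulrA -natrM big_cons; congr ((_ * _)%:R * c _ * _).
  apply: eq_big_seq => i si; rewrite !ffunE.
  by case: eqP si js => [->->//|_ _ _]; rewrite mul0n addn0.
apply/ffunP => i; rewrite !ffunE inE -addnA; congr (_ + _)%N.
by case: eqP => [->|_] /=; rewrite ?(negPf js) ?mul0n ?addn0 // add0n.
Qed.

(** Taylor's formula F^(J)(z0) = J! c_J. *)
Lemma mderiv_center F z0 c rho (J : 'I_n -> nat) : has_series F z0 c rho ->
  mderiv F J z0 = (mi_fact J)%:R * c [ffun i => J i].
Proof.
move=> /(series_mderiv J)/series_center ->; congr (_%:R * c _).
  by apply: eq_bigr => i _; rewrite ffunE add0n ffactnn.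
by apply/ffunP => i; rewrite !ffunE.
Qed.

End PowerSeries.

End PowerSeriesTheory.

(** * Maximum principle and Schwarz's lemma on the unit disc *)

Section UnitDisc.
Context (R : realType).

(** Taylor expansion of order d at 0, with remainder O(w^d). The maximum
    principle below asks for nothing more than such expansions at every point
    of a disc, and they are stable under linear combinations and under
    division by a nonvanishing linear factor. *)
Definition jet (d : nat) (g : R[i] -> R[i]) (a : nat -> R[i]) :=
  exists (t C : R), [/\ 0 < t, 0 <= C & forall w, cmod w <= t ->
    cmod (g w - \sum_(m < d) a m * w ^+ m) <= C * cmod w ^+ d].

(** Along a complex line through its centre a power series becomes the series
    of its homogeneous parts. For |w| <= t the terms of degree at least d lose
    a factor (|w| / t)^d against their values at |w| = t, whose sum is finite. *)
Lemma line_jet (n : nat) (F : 'rV[CC R]_n -> CC R) y c rho (v : 'rV[CC R]_n) d :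
  has_series F y c rho ->
  exists a : nat -> R[i],
    (forall m, sums_to (fun K : {ffun 'I_n -> nat} =>
       if mi_norm K == m then c K * \prod_j v 0 j ^+ K j else 0) (a m)) /\
    jet d (fun w => F (y + w *: v)) a.
Proof.
move=> Fc; have [rho0 Fs] := Fc.
pose V := \sum_j cmod (v 0 j).
have V0 : 0 <= V by apply: sumr_ge0 => j _; exact: cmod_ge0.
pose t := rho / (V + 1).
have t0 : 0 < t by rewrite divr_gt0 // ltr_wpDl.
have vt j : cmod (v 0 j) * t < rho.
  rewrite mulrA ltr_pdivrMr ?ltr_wpDl // mulrC ltr_pM2l //.
  have : cmod (v 0 j) <= V.
    by rewrite /V (bigD1 j) //= lerDl sumr_ge0 // => i _; exact: cmod_ge0.
  by move=> /le_lt_trans; apply; rewrite ltrDl.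
have [|b hb] := @series_abs_bounded _ _ _ _ _ _ (fun j => cmod (v 0 j) * t) Fc.
  by move=> j; rewrite vt mulr_ge0 ?cmod_ge0 // ltW.
pose T K := c K * \prod_j v 0 j ^+ K j.
have TE K : cmod (c K) * \prod_j (cmod (v 0 j) * t) ^+ K j
    = cmod (T K) * t ^+ mi_norm K.
  rewrite /T cmodM cmod_prod -mulrA; congr (_ * _).
  under eq_bigr do rewrite exprMn.
  rewrite big_split /= prodrXr; congr (_ * _).
  by apply: eq_bigr => j _; rewrite cmodX.
have {}hb (A : {fset {ffun 'I_n -> nat}}) : \sum_(K <- A) cmod (T K) * t ^+ mi_norm K <= b.
  by apply: le_trans (hb A); apply: ler_sum => K _; rewrite TE.
have aex m : exists am, sums_to (fun K : {ffun 'I_n -> nat} =>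
    if mi_norm K == m then T K else 0) am.
  apply: (@abs_bounded_sums_to _ _ _ (t ^- m * b)) => A.
  rewrite ler_pdivlMl ?exprn_gt0 //; apply: le_trans (hb A).
  rewrite mulr_sumr; apply: ler_sum => K _; case: eqP => [->|_].
    by rewrite mulrC.
  by rewrite cmod0 mulr0 mulr_ge0 ?cmod_ge0 // exprn_ge0 // ltW.
have [a ha] := choice aex.
exists a; split=> //; exists t, (t ^- d * b).
have b0 : 0 <= b by have := hb fset0; rewrite big_seq_fset0.
split=> // [|w wt]; first by rewrite mulr_ge0 // invr_ge0 exprn_ge0 // ltW.
have Sw : sums_to (fun K : {ffun 'I_n -> nat} => T K * w ^+ mi_norm K)
    (F (y + w *: v)).
  have zE j : (y + w *: v) 0 j - y 0 j = v 0 j * w.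
    by rewrite !mxE addrC addKr mulrC.
  apply: eq_sums_to (Fs _ _) => [K|j].
    rewrite /T -mulrA; congr (_ * _).
    under eq_bigr do rewrite zE exprMn.
    by rewrite big_split /= prodrXr.
  rewrite zE cmodM (le_lt_trans _ (vt j)) // ler_wpM2l ?cmod_ge0 //.
have Sd := sums_toB Sw (sums_to_sum (index_enum 'I_d)
   (fun m => sums_toZ (w ^+ m) (ha m))).
under eq_bigr do rewrite mulrC.
apply: (sums_to_le Sd).
rewrite -mulrA [b * _]mulrC mulrA => A.
apply: le_trans (ler_wpM2l _ (hb A)); last first.
  by rewrite mulr_ge0 ?exprn_ge0 ?cmod_ge0 // invr_ge0 exprn_ge0 // ltW.
rewrite mulr_sumr; apply: ler_sum => K _.
have [Kd|dK] := ltnP (mi_norm K) d.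
  rewrite (bigD1 (Ordinal Kd)) //= eqxx big1 => [|m mK].
    rewrite addr0 mulrC subrr cmod0.
    by rewrite !mulr_ge0 ?invr_ge0 ?exprn_ge0 ?cmod_ge0 // ltW.
  case: (mi_norm K =P m) => [e|_]; last by rewrite mulr0.
  by move: mK; rewrite -val_eqE /= -e eqxx.
rewrite big1 => [|m _]; last first.
  case: (mi_norm K =P m) => [e|_]; last by rewrite mulr0.
  by move: dK; rewrite e leqNgt ltn_ord.
rewrite subr0 cmodM cmodX mulrCA ler_wpM2l ?cmod_ge0 //.
rewrite -(subnKC dK) !exprD mulrACA mulVf ?expf_neq0 ?gt_eqF // mul1r.
by rewrite ler_wpM2l ?exprn_ge0 ?cmod_ge0 // lerXn2r ?nnegrE ?cmod_ge0 // ltW.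
Qed.

Lemma jet_center d g a : jet d.+1 g a -> g 0 = a 0%N.
Proof.
move=> [t [C [t0 C0 /(_ 0)]]]; rewrite cmod0 expr0n mulr0 => /(_ (ltW t0)).
rewrite big_ord_recl expr0 mulr1 big1 ?addr0 => [h|i _]; last first.
  by rewrite expr0n mulr0.
apply/eqP; rewrite -subr_eq0 -cmod_eq0 eq_le cmod_ge0 andbT //.
Qed.

Lemma eq_jet d g g' a (t : R) : 0 < t -> (forall w, cmod w <= t -> g w = g' w) ->
  jet d g a -> jet d g' a.
Proof.
move=> t0 gg' [s [C [s0 C0 h]]]; exists (Num.min t s), C.
split=> // [|w]; first by rewrite lt_min t0.
by rewrite le_min => /andP[wt ws]; rewrite -gg' ?h.
Qed.

Lemma jet_lipschitz d g a : jet d.+1 g a ->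
  exists t C : R, [/\ 0 < t, 0 <= C & forall w, cmod w <= t ->
    cmod (g w - g 0) <= C * cmod w].
Proof.
move=> ga; rewrite (jet_center ga); case: ga => t [C [t0 C0 h]].
pose D := \sum_(m < d) cmod (a m.+1).
have D0 : 0 <= D by apply: sumr_ge0 => j _; exact: cmod_ge0.
exists (Num.min 1 t), (C + D); split; rewrite ?lt_min ?ltr01 ?addr_ge0 //.
move=> w; rewrite le_min => /andP[w1 /h {}h].
have wX m : cmod w ^+ m.+1 <= cmod w.
  by rewrite exprS -[leRHS]mulr1 ler_wpM2l ?exprn_ile1 ?cmod_ge0.
move: h; rewrite big_ord_recl expr0 mulr1 /bump /=; set s := \sum_(i < d) _ => h.
rewrite (_ : g w - a 0%N = (g w - (a 0%N + s)) + s); last by ring.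
rewrite (le_trans (cmodD _ _)) // mulrDl lerD //.
  by rewrite (le_trans h) // ler_wpM2l.
rewrite /D mulr_suml (le_trans (cmod_sum _ _ _)) //; apply: ler_sum => m _.
rewrite cmodM cmodX ler_wpM2l ?cmod_ge0 //.
Qed.

Lemma sum3E (a : nat -> R[i]) w :
  \sum_(m < 3) a m * w ^+ m = a 0%N + a 1%N * w + a 2%N * w ^+ 2.
Proof.
by rewrite !big_ord_recl big_ord0 addr0 expr0 mulr1 expr1 addrA.
Qed.

Lemma cmodD4 (x1 x2 x3 x4 : R[i]) (e1 e2 e3 e4 : R) :
  cmod x1 <= e1 -> cmod x2 <= e2 -> cmod x3 <= e3 -> cmod x4 <= e4 ->
  cmod (x1 + x2 + x3 + x4) <= e1 + e2 + e3 + e4.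
Proof.
move=> h1 h2 h3 h4; rewrite (le_trans (cmodD _ _)) // lerD //.
by rewrite (le_trans (cmodD _ _)) // lerD // (le_trans (cmodD _ _)) // lerD.
Qed.

(** The coefficients of the quotient solve (z + w) (b0 + b1 w + b2 w^2) = a0 +
    a1 w + a2 w^2 + b2 w^3, and z + w stays away from 0 for |w| <= |z| / 2. *)
Lemma jet3_div g a z : z != 0 -> jet 3 g a ->
  exists b, jet 3 (fun w => g w / (z + w)) b.
Proof.
move=> z0 [t [C [t0 C0 h]]].
pose b0 := a 0%N / z; pose b1 := (a 1%N - b0) / z; pose b2 := (a 2%N - b1) / z.
pose b m := if m == 0%N then b0 else if m == 1%N then b1 else b2; exists b.
have zp : 0 < cmod z by rewrite cmod_gt0.
have z2 : 0 < cmod z / 2 by rewrite divr_gt0.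
exists (Num.min t (cmod z / 2)), ((C + cmod b2) / (cmod z / 2)).
split=> [||w].
- by rewrite lt_min t0.
- by rewrite divr_ge0 ?addr_ge0 ?cmod_ge0 // ltW.
rewrite le_min => /andP[/h]; rewrite !sum3E {}/b /= => {}h wz.
have zw : cmod z / 2 <= cmod (z + w).
  have := cmodB (z + w) w; rewrite addrK; lra.
have zw0 : z + w != 0 by rewrite -cmod_gt0 (lt_le_trans z2).
set p := a 0%N + _ + _ in h.
have -> : g w / (z + w) - (b0 + b1 * w + b2 * w ^+ 2) =
    ((g w - p) - b2 * w ^+ 3) / (z + w).
  by rewrite /p /b2 /b1 /b0; field; rewrite z0 zw0.
rewrite cmodM cmodV ler_pdivrMr ?(lt_le_trans z2) //.
rewrite (@le_trans _ _ ((C + cmod b2) * cmod w ^+ 3)) //.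
  rewrite (le_trans (cmodB _ _)) // [leRHS]mulrDl (cmodM b2) cmodX lerD //.
have -> : (C + cmod b2) * cmod w ^+ 3 =
    (C + cmod b2) / (cmod z / 2) * cmod w ^+ 3 * (cmod z / 2).
  by field; apply: lt0r_neq0.
by rewrite ler_wpM2l // mulr_ge0 ?exprn_ge0 ?divr_ge0 ?addr_ge0 ?cmod_ge0 ?(ltW z2).
Qed.

Lemma jet3_divX g a z k : z != 0 -> jet 3 g a ->
  exists b, jet 3 (fun w => g w / (z + w) ^+ k) b.
Proof.
move=> z0 ga; elim: k => [|k [b hb]].
  exists a; apply: eq_jet ltr01 _ ga => w _; by rewrite expr0 divr1.
have [b' hb'] := jet3_div z0 hb; exists b'; apply: eq_jet ltr01 _ hb' => w _.
by rewrite -mulrA -invfM exprSr.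
Qed.

(** Discrete mean value property: the sums of the four numbers [x, ix, -x,
    -ix] and of their squares vanish, so the terms of degree one and two
    cancel. *)
Lemma jet3_four_point g a : jet 3 g a ->
  exists t C : R, [/\ 0 < t, 0 <= C & forall x i : R[i],
    cmod x <= t -> i ^+ 2 = -1 ->
    cmod (g x + g (i * x) + g (- x) + g (- (i * x)) - 4 * g 0)
      <= C * cmod x ^+ 3].
Proof.
move=> ga; rewrite (jet_center ga); case: ga => t [C [t0 C0 h]].
exists t, (4 * C); split=> // [|x i xt ii]; first by rewrite mulr_ge0.
have ci : cmod i = 1.
  apply/eqP; rewrite -(@eqrXn2 _ 2) ?cmod_ge0 // -cmodX ii cmodN cmod1.
  by rewrite expr1n.
have E w : cmod w = cmod x ->
    cmod (g w - \sum_(m < 3) a m * w ^+ m) <= C * cmod x ^+ 3.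
  by move=> wx; rewrite -wx h // wx.
have E2 := E (i * x); rewrite cmodM ci mul1r in E2.
have E3 := E (- x); rewrite cmodN in E3.
have E4 := E (- (i * x)); rewrite cmodN cmodM ci mul1r in E4.
move: (cmodD4 (E x erefl) (E2 erefl) (E3 erefl) (E4 erefl)).
rewrite !sum3E !sqrrN exprMn ii.
set l := (X in cmod X <= _); set r := (X in _ -> cmod X <= _).
have -> : l = r by rewrite /l /r; ring.
by move=> /le_trans; apply; rewrite le_eqVlt; apply/orP; left; apply/eqP; ring.
Qed.

Lemma sqr_cmod (z : R[i]) : cmod z ^+ 2 = complex.Re z ^+ 2 + complex.Im z ^+ 2.
Proof. by case: z => x y /=; rewrite sqr_sqrtr // addr_ge0 ?sqr_ge0. Qed.

Lemma sqr_cmod_four_point (z : R[i]) (s : R) :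
  cmod (z + s%:C) ^+ 2 + cmod (z + 'i%C * s%:C) ^+ 2 + cmod (z - s%:C) ^+ 2
    + cmod (z - 'i%C * s%:C) ^+ 2 = 4 * cmod z ^+ 2 + 4 * s ^+ 2.
Proof. by case: z => x y; rewrite !sqr_cmod /=; ring. Qed.

Definition disc_points : set (R * R) := [set p | p.1 ^+ 2 + p.2 ^+ 2 <= 1].

Lemma disc_compact : compact disc_points.
Proof.
have Kc : compact (`[(-1 : R), 1]%classic `*` `[(-1 : R), 1]%classic).
  by apply: compact_setX; exact: segment_compact.
apply: (subclosed_compact _ Kc).
  have fc : continuous (fun p : R * R => p.1 ^+ 2 + p.2 ^+ 2).
    move=> p; apply: cvgD; apply: cvgM; solve [exact: cvg_fst|exact: cvg_snd].
  apply: (@preimage_closed _ _ (fun p : R * R => p.1 ^+ 2 + p.2 ^+ 2) [set x | x <= 1]).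
    by move=> p _; exact: fc.
  exact: (@closed_le R 1).
move=> [x y]; rewrite /disc_points /= => h.
have x2 := sqr_ge0 x; have y2 := sqr_ge0 y.
by split; rewrite /= in_itv /=; apply/andP; split; nra.
Qed.

(** Maximum principle. With a = h(0) maximise u(z) = Re(conj(a) h(z)) + e
    |z|^2 on the closed disc. At an interior maximum the four-point mean of u
    exceeds u(z) by e s^2 - O(s^3), which is impossible for small s; on the
    boundary u <= |a| M + e. Hence |a|^2 = u(0) <= |a| M + e for every e > 0. *)
Lemma max_principle (h : R[i] -> R[i]) (M : R) :
  (forall z, cmod z <= 1 -> exists a, jet 3 (fun w => h (z + w)) a) ->
  (forall z, cmod z = 1 -> cmod (h z) <= M) -> cmod (h 0) <= M.
Proof.
move=> hjet hM; set a := h 0.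
have M0 : 0 <= M by apply: le_trans (cmod_ge0 _) (hM 1 (cmod1 R)).
have key (e : R) : 0 < e -> cmod a ^+ 2 <= cmod a * M + e.
  move=> e0.
  pose zof (p : R * R) : R[i] := p.1%:C + 'i%C * p.2%:C.
  have zofE p : cmod (zof p) ^+ 2 = p.1 ^+ 2 + p.2 ^+ 2.
    by rewrite sqr_cmod /zof /=; ring.
  have zofD p q : zof (p + q) = zof p + zof q.
    by rewrite /zof /= !rmorphD; ring.
  pose U z : R := complex.Re (a^*%C * h z) + e * cmod z ^+ 2.
  have U_cont : {within disc_points, continuous (U \o zof)}.
    apply: continuous_in_subspaceT => p; rewrite inE => pA.
    have z1 : cmod (zof p) <= 1.
      by rewrite -(@expr_le1 _ 2) ?cmod_ge0 // zofE.
    have [b /jet_lipschitz[t [C [t0 C0 ht]]]] := hjet _ z1.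
    set z := zof p in z1 ht.
    pose D := cmod a * C + e * 3.
    have D0 : 0 < D by rewrite ltr_wpDl ?mulr_ge0 ?cmod_ge0 // mulr_gt0.
    have lipU w : cmod w <= t -> cmod w <= 1 -> `|U z - U (z + w)| <= D * cmod w.
      move=> wt w1; rewrite /U; set x := _ * h z; set y := _ * h (z + w).
      have -> : complex.Re x + e * cmod z ^+ 2
              - (complex.Re y + e * cmod (z + w) ^+ 2) =
          (complex.Re x - complex.Re y) + e * (cmod z ^+ 2 - cmod (z + w) ^+ 2).
        by ring.
      rewrite (le_trans (ler_normD _ _)) // /D mulrDl lerD //.
        have -> : complex.Re x - complex.Re y = complex.Re (x - y).
          by case: x; case: y.
        rewrite (le_trans (Re_le_cmod _)) // /x /y -mulrBr cmodM -mulrA.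
        have -> : cmod a^*%C = cmod a by case: (a) => ? ? /=; rewrite sqrrN.
        rewrite ler_wpM2l ?cmod_ge0 // cmod_distC.
        by have := ht w wt; rewrite addr0.
      rewrite normrM (ger0_norm (ltW e0)) -mulrA ler_wpM2l ?(ltW e0) //.
      have h1 := cmodD z w; have h2 := cmodB (z + w) w; rewrite addrK in h2.
      have h3 := cmod_ge0 z; have h4 := cmod_ge0 (z + w); have h5 := cmod_ge0 w.
      rewrite ler_norml; apply/andP; split; nra.
    apply/cvgrPdist_le => eps eps0.
    pose r := Num.min (Num.min t 1) (eps / D) / 2.
    have r0 : 0 < r by rewrite divr_gt0 // !lt_min t0 ltr01 divr_gt0.
    apply: (filterS _ (nbhsx_ballx p r r0)) => q [/= q1 q2].
    have wr : cmod (zof (q - p)) <= Num.min (Num.min t 1) (eps / D).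
      rewrite (le_trans (cmodD _ _)) // cmodM !cmod_real.
      have -> : cmod 'i%C = 1 :> R by rewrite /= expr0n add0r expr1n sqrtr1.
      rewrite mul1r [leRHS]splitr /= lerD //.
        by rewrite distrC ltW.
      by rewrite distrC ltW.
    rewrite le_min [X in X && _]le_min in wr; case/andP: wr => /andP[wt w1 we].
    rewrite (_ : q = p + (q - p)); last by rewrite addrC subrK.
    rewrite /= zofD (le_trans (lipU _ wt w1)) //.
    by rewrite mulrC -ler_pdivlMr.
  have [|p pA pmax] := compact_EVT_max _ disc_compact U_cont.
    by exists 0; rewrite /disc_points /= !expr0n addr0 ler01.
  rewrite inE in pA.
  have z1 : cmod (zof p) <= 1.
    by rewrite -(@expr_le1 _ 2) ?cmod_ge0 // zofE.
  set z := zof p in z1 pmax.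
  have Umax w : cmod w <= 1 -> U w <= U z.
    move=> w1; have := pmax (complex.Re w, complex.Im w).
    rewrite inE /= /zof /= -complexE; apply.
    by rewrite /disc_points /= -sqr_cmod expr_le1 ?cmod_ge0.
  have aJ : cmod a^*%C = cmod a by case: (a) => ? ? /=; rewrite sqrrN.
  have [z_in|z_out] := ltP (cmod z) 1; last first.
    have zE : cmod z = 1 by apply: le_anti; rewrite z1.
    have U0 : U 0 = cmod a ^+ 2.
      rewrite /U -/a cmod0 expr0n mulr0 addr0 sqr_cmod.
      by case: (a) => ? ? /=; ring.
    rewrite -U0 (le_trans (Umax _ _)) ?cmod0 // /U zE expr1n mulr1 lerD2r.
    rewrite (le_trans (ler_norm _)) // (le_trans (Re_le_cmod _)) // cmodM aJ.
    by rewrite ler_wpM2l ?cmod_ge0 // hM.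
  have [b /jet3_four_point[t [C [t0 C0 ht]]]] := hjet _ z1.
  (* The step [s] is such that |a| C s^3 <= e s^2 and z + w stays in the disc. *)
  pose D := cmod a * C + 1.
  have D0 : 0 < D by rewrite ltr_wpDl // mulr_ge0 ?cmod_ge0.
  pose s := Num.min (Num.min t (1 - cmod z)) (e / D).
  have s0 : 0 < s by rewrite !lt_min t0 subr_gt0 z_in divr_gt0.
  have := lexx s; rewrite {2}/s !le_min => /andP[/andP[st sz] sD].
  have cs : cmod s%:C = s by rewrite cmod_real ger0_norm // ltW.
  have ci : cmod 'i%C = 1 :> R by rewrite /= expr0n add0r expr1n sqrtr1.
  have := ht s%:C 'i%C; rewrite cs => /(_ st (sqr_i _)) {}ht.
  have Uw w : cmod w = s -> U (z + w) <= U z.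
    by move=> ws; apply: Umax; rewrite (le_trans (cmodD _ _)) // ws; lra.
  have U1 := Uw s%:C cs.
  have := Uw ('i%C * s%:C); rewrite cmodM ci mul1r => /(_ cs) U2.
  have := Uw (- s%:C); rewrite cmodN => /(_ cs) U3.
  have := Uw (- ('i%C * s%:C)); rewrite cmodN cmodM ci mul1r => /(_ cs) U4.
  have E := sqr_cmod_four_point z s.
  move: ht U1 U2 U3 U4 E; rewrite /U addr0.
  move: (cmod (z + s%:C) ^+ 2) (cmod (z + 'i%C * s%:C) ^+ 2).
  move: (cmod (z - s%:C) ^+ 2) (cmod (z - 'i%C * s%:C) ^+ 2).
  move: (h (z + s%:C)) (h (z + 'i%C * s%:C)) (h (z - s%:C)) (h (z - 'i%C * s%:C)).
  move: (h z) (cmod z ^+ 2) => y0 N y1 y2 y3 y4 N3 N4 N1 N2.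
  set S := _ - 4 * y0 => hS U1 U2 U3 U4 E; exfalso.
  have RS : - complex.Re (a^*%C * S) <= cmod a * (C * s ^+ 3).
    apply: le_trans (ler_norm _) _; rewrite normrN.
    by rewrite (le_trans (Re_le_cmod _)) // cmodM aJ ler_wpM2l ?cmod_ge0.
  have RE : complex.Re (a^*%C * S) = complex.Re (a^*%C * y1) + complex.Re (a^*%C * y2)
     + complex.Re (a^*%C * y3) + complex.Re (a^*%C * y4) - 4 * complex.Re (a^*%C * y0).
    rewrite /S; case: (a^*%C) y0 y1 y2 y3 y4 {RS S hS U1 U2 U3 U4}.
    by move=> ? ? [? ?] [? ?] [? ?] [? ?] [? ?] /=; ring.
  have s3 : cmod a * (C * s ^+ 3) <= e * s ^+ 2.
    have -> : cmod a * (C * s ^+ 3) = (cmod a * C * s) * s ^+ 2 by ring.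
    rewrite ler_wpM2r ?sqr_ge0 //; rewrite ler_pdivlMr // in sD.
    apply: le_trans sD; by rewrite mulrC ler_wpM2l ?(ltW s0) // /D lerDl ler01.
  have es2 : 0 < e * s ^+ 2 by rewrite mulr_gt0 // exprn_gt0.
  have : e * (N1 + N2 + N3 + N4) = 4 * (e * N) + 4 * (e * s ^+ 2).
    by rewrite E; ring.
  lra.
have [a0|a0] := leP (cmod a) 0; first exact: le_trans a0 M0.
apply/ler_addgt0Pr => e e0; rewrite -(ler_pM2l a0) mulrDr -expr2.
by apply: key; rewrite mulr_gt0.
Qed.

(** The quotient H(z) / z^k, completed by the value [a] at 0, has expansions
    of order three on the closed disc and is bounded by M on the circle: this
    is the argument of Schwarz's lemma. At 0 the expansion up to order k + 3
    leaves, after division, one of order three. *)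
Lemma cauchy_coef (H : R[i] -> R[i]) (k : nat) (a : R[i]) (M : R) :
  (forall z, cmod z <= 1 -> exists b, jet 3 (fun w => H (z + w)) b) ->
  jet (k + 3) H (fun m => if m == k then a else 0) ->
  (forall z, cmod z = 1 -> cmod (H z) <= M) -> cmod a <= M.
Proof.
move=> Hjet H0 HM; pose h z := if z == 0 then a else H z / z ^+ k.
have -> : a = h 0 by rewrite /h eqxx.
apply: max_principle => [z z1|z z1]; last first.
  have z0 : z != 0 by rewrite -cmod_gt0 z1.
  by rewrite /h (negPf z0) cmodM cmodV cmodX z1 expr1n invr1 mulr1 HM.
have [->|z0] := eqVneq z 0; last first.
  have [b /(jet3_divX k z0)[b' hb']] := Hjet z z1; exists b'.
  have zp : 0 < cmod z / 2 by rewrite divr_gt0 // cmod_gt0.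
  apply: (eq_jet zp _ hb') => w wz; rewrite /h ifN //.
  rewrite -cmod_gt0; have := cmodB (z + w) w; rewrite addrK; lra.
pose b m := if m == 0%N then a else 0; exists b.
case: H0 => t [C [t0 C0 hH]]; exists t, C; split=> // w wt.
rewrite sum3E /b /= !mul0r !addr0 add0r /h.
have [->|w0] := eqVneq w 0.
  by rewrite subrr cmod0 mulr_ge0 // exprn_ge0 // cmod_ge0.
have wp : 0 < cmod w by rewrite cmod_gt0.
have kk : (k < k + 3)%N by rewrite -[ltnLHS]addn0 ltn_add2l.
have := hH w wt; rewrite (bigD1 (Ordinal kk)) //=.
rewrite eqxx big1 ?addr0 => [|i ik]; last first.
  case: (nat_of_ord i =P k) => [e|_]; last by rewrite mul0r.
  by move: ik; rewrite -val_eqE /= e eqxx.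
have -> : H w / w ^+ k - a = (H w - a * w ^+ k) / w ^+ k.
  by rewrite mulrBl mulfK // expf_neq0.
rewrite cmodM cmodV cmodX ler_pdivrMr ?exprn_gt0 // -mulrA -exprD addnC //.
Qed.

End UnitDisc.

(** * Cauchy's inequality on a polydisc *)

Section Cauchy.
Context (R : realType).

Lemma jet_sum (I : finType) d (x : I -> R[i]) (g : I -> R[i] -> R[i])
    (a : I -> nat -> R[i]) :
  (forall e, jet d (g e) (a e)) ->
  jet d (fun w => \sum_e x e * g e w) (fun m => \sum_e x e * a e m).
Proof.
move=> ga.
suff H (s : seq I) : jet d (fun w => \sum_(e <- s) x e * g e w)
   (fun m => \sum_(e <- s) x e * a e m) by exact: H.
elim: s => [|e s [t [C [t0 C0 h]]]].
  exists 1, 0; split=> // w _; rewrite big_nil big1 => [|i _].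
    by rewrite subrr cmod0 mul0r.
  by rewrite big_nil mul0r.
have [t' [C' [t'0 C'0 h']]] := ga e.
exists (Num.min t t'), (cmod (x e) * C' + C); split=> [||w].
- by rewrite lt_min t0.
- by rewrite addr_ge0 ?mulr_ge0 ?cmod_ge0.
rewrite le_min => /andP[/h {}h /h' {}h']; rewrite big_cons.
under [X in _ - X]eq_bigr do rewrite big_cons mulrDl -mulrA.
rewrite big_split -mulr_sumr /= opprD addrACA -mulrBr.
rewrite (le_trans (cmodD _ _)) // mulrDl lerD // cmodM -mulrA.
by rewrite ler_wpM2l ?cmod_ge0.
Qed.

Lemma eq_jet_coef d g (a b : nat -> R[i]) :
  (forall m, (m < d)%N -> a m = b m) -> jet d g a -> jet d g b.
Proof.
move=> ab [t [C [t0 C0 h]]]; exists t, C; split=> // w /h.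
by under eq_bigr => m _ do rewrite ab //.
Qed.

(** 'X^N - 1 splits and is separable, so it has N distinct roots, and a group
    of N roots of unity of order N in a field is cyclic. *)
Lemma prim_root_exists (N : nat) : (0 < N)%N ->
  exists w : R[i], N.-primitive_root w.
Proof.
move=> N0; pose p : {poly R[i]} := 'X^N - 1.
have [r pr] := closed_field_poly_normal p.
have p0 : p != 0 by rewrite monic_neq0 ?monic_Xn_sub_1.
have lp : lead_coef p = 1 by apply/monicP; exact: monic_Xn_sub_1.
rewrite lp scale1r in pr.
have rs : all N.-unity_root r.
  apply/allP => x xr; rewrite /root_of_unity -/p pr.
  by rewrite root_prod_XsubC.
have ur : uniq r.
  rewrite -separable.separable_prod_XsubC -pr; apply: cyclotomic.separable_Xn_sub_1.
  by rewrite pnatr_eq0 -lt0n.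
have sr : size r = N.
  by apply/succn_inj; rewrite -(size_prod_XsubC r id) -pr size_Xn_sub_1.
have := cyclic.has_prim_root N0 rs ur; rewrite sr leqnn => /(_ erefl)/hasP[w _ hw].
by exists w.
Qed.

Lemma unity_root_cmod N (w : R[i]) : (0 < N)%N -> w ^+ N = 1 -> cmod w = 1.
Proof.
move=> N0 wN; apply/eqP; rewrite -(@eqrXn2 _ N) ?cmod_ge0 // -cmodX wN cmod1.
by rewrite expr1n.
Qed.

(** A geometric sum of ratio y = w^(k - j), where y^N = 1. *)
Lemma root_orthogonality N (w : R[i]) (j k : nat) : N.-primitive_root w ->
  \sum_(i < N) (w ^+ (i * j))^-1 * (w ^+ i) ^+ k
    = if (k == j %[mod N])%N then N%:R else 0.
Proof.
move=> wp; have wN := prim_expr_order wp.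
have w0 : w != 0 by rewrite (prim_root_eq0 wp) -lt0n (prim_order_gt0 wp).
pose y := w ^+ k / w ^+ j.
have yN : y ^+ N = 1.
  by rewrite expr_div_n -!exprM mulnC exprM wN expr1n mulnC exprM wN expr1n divr1.
rewrite (eq_bigr (fun i : 'I_N => y ^+ i)) => [|i _]; last first.
  by rewrite /y expr_div_n -!exprM mulrC (mulnC k) (mulnC j).
rewrite -(eq_prim_root_expr wp).
have [e|ne] := eqVneq (w ^+ k) (w ^+ j).
  rewrite /y e divff ?expf_neq0 //.
  under eq_bigr do rewrite expr1n.
  by rewrite sumr_const card_ord.
have y1 : y - 1 != 0.
  rewrite subr_eq0; apply: contra ne => /eqP y1.
  by rewrite -[w ^+ j]mul1r -y1 divfK ?expf_neq0.
by apply: (mulfI y1); rewrite -subrX1 yN subrr mulr0.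
Qed.

Lemma torus_orthogonality N (w : R[i]) (n : nat) (J K : 'I_n -> nat) :
  N.-primitive_root w ->
  \sum_(e : {ffun 'I_n -> 'I_N})
     (\prod_j w ^+ (e j * J j))^-1 * \prod_j (w ^+ e j) ^+ K j
    = if [forall j, (K j == J j %[mod N])%N] then (N ^ n)%:R else 0.
Proof.
move=> wp.
pose f j (i : 'I_N) := (w ^+ (i * J j))^-1 * (w ^+ i) ^+ K j.
transitivity (\prod_j \sum_(i < N) f j i).
  rewrite bigA_distr_bigA /=; apply: eq_bigr => e _.
  by rewrite -prodfV -big_split.
under eq_bigr do rewrite root_orthogonality //.
case: forallP => [h|/forallP].
  rewrite (eq_bigr (fun=> N%:R)) => [|j _]; last by rewrite h.
  by rewrite prodr_const card_ord natrX.
rewrite negb_forall => /existsP[j hj].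
by rewrite (bigD1 j) //= (negPf hj) mul0r.
Qed.

Lemma leq_mi_norm n (K : 'I_n -> nat) j : (K j <= mi_norm K)%N.
Proof. by rewrite /mi_norm (bigD1 j) //= leq_addr. Qed.

(** Cauchy's inequality on a polydisc. Restrict G to the complex lines through
    z0 in the directions (r_j w^(e_j))_j, with w a primitive N-th root of
    unity, and average them over e with the weights w^(- sum_j e_j J_j). By
    orthogonality only the terms with K = J modulo N survive, and for N = |J|
    + 3 the only one of degree less than N is c_J r^J zeta^|J|. The average is
    bounded by M on the closed unit disc, so [cauchy_coef] applies to it. *)
Lemma cauchy_polydisc (n : nat) (G : 'rV[CC R]_n -> CC R) (z0 : 'rV[CC R]_n) c rho
    (r : 'rV[R]_n) (M : R) (J : {ffun 'I_n -> nat}) :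
  (forall j, 0 <= r 0 j) -> has_series G z0 c rho ->
  (forall z, closed_polydisc z0 r z -> exists c' rho', has_series G z c' rho') ->
  (forall z, closed_polydisc z0 r z -> cmod (G z) <= M) ->
  cmod (c J) * \prod_j r 0 j ^+ J j <= M.
Proof.
move=> r0 Gc Gs GM; pose k := mi_norm J; pose N := (k + 3)%N.
have N0 : (0 < N)%N by rewrite /N addn3.
have [w wp] := prim_root_exists N0.
have w1 : cmod w = 1 by apply: unity_root_cmod N0 (prim_expr_order wp).
pose E := {ffun 'I_n -> 'I_N}.
pose v (e : E) : 'rV[CC R]_n := \row_j ((r 0 j)%:C * w ^+ e j).
pose wt (e : E) : R[i] := (N ^ n)%:R^-1 * (\prod_j w ^+ (e j * J j))^-1.
pose H (z : R[i]) : R[i] := \sum_e wt e * G (z0 + z *: v e).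
have in_disc (z : R[i]) e : cmod z <= 1 -> closed_polydisc z0 r (z0 + z *: v e).
  move=> z1 j; rewrite !mxE [z0 0 j + _]addrC addrK !cmodM cmodX w1 expr1n mulr1.
  by rewrite cmod_real ger0_norm // ler_piMl.
have Nn0 : (N ^ n)%:R != 0 :> R[i] by rewrite pnatr_eq0 expn_eq0 negb_and -lt0n N0.
have cr : cmod (c J * \prod_j (r 0 j)%:C ^+ J j) = cmod (c J) * \prod_j r 0 j ^+ J j.
  rewrite cmodM cmod_prod; congr (_ * _); apply: eq_bigr => j _.
  by rewrite cmodX cmod_real ger0_norm.
rewrite -cr; apply: (@cauchy_coef _ H k).
- move=> z z1.
  have /choice[a ha] : forall e, exists a, jet 3 (fun x => G (z0 + (z + x) *: v e)) a.
    move=> e; have [c' [rho' Gc']] := Gs _ (in_disc z e z1).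
    have [a [_ ja]] := line_jet (v e) 3 Gc'; exists a.
    by apply: (eq_jet ltr01 _ ja) => x _; rewrite scalerDl addrA.
  by exists (fun m => \sum_e wt e * a e m); exact: jet_sum.
- have /choice[a ha] := fun e => line_jet (v e) (k + 3) Gc.
  have := jet_sum wt (fun e => (ha e).2); apply: eq_jet_coef => m mk.
  have := sums_to_sum (index_enum E) (fun e => sums_toZ (wt e) ((ha e).1 m)).
  set f := fun K => _ => hf.
  have fE K : f K = if (K == J) && (m == k)
                    then c J * \prod_j (r 0 j)%:C ^+ J j else 0.
    rewrite /f; case: (mi_norm K =P m) => [Km|Km]; last first.
      rewrite big1 => [|e _]; last by rewrite mulr0.
      by case: eqP Km => [-> /eqP/negPf|//]; rewrite eq_sym => ->; rewrite andbF.
    transitivity (c K * (\prod_j (r 0 j)%:C ^+ K j) * ((N ^ n)%:R^-1 *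
      \sum_(e : E) (\prod_j w ^+ (e j * J j))^-1 * \prod_j (w ^+ e j) ^+ K j)).
      rewrite !mulr_sumr; apply: eq_bigr => e _.
      have -> : \prod_j v e 0 j ^+ K j =
          (\prod_j (r 0 j)%:C ^+ K j) * \prod_j (w ^+ e j) ^+ K j.
        by rewrite -big_split; apply: eq_bigr => j _; rewrite mxE exprMn.
      by rewrite /wt; ring.
    rewrite torus_orthogonality //.
    have -> : [forall j, (K j == J j %[mod N])%N] = (K == J).
      apply/forallP/eqP => [h|-> //]; apply/ffunP => j; have := h j.
      rewrite !modn_small => [/eqP//||].
        by rewrite (leq_ltn_trans (leq_mi_norm _ j)) // /N -addn1 leq_add2l.
      by rewrite (leq_ltn_trans (leq_mi_norm _ j)) // Km.
    case: eqP => [KJ|_] /=; last by rewrite !mulr0.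
    by rewrite -Km KJ eqxx mulVf // mulr1.
  apply: (sums_to_unique hf).
  have := @sums_to_finite R _ f [fset J]%fset; rewrite big_seq_fset1 !fE eqxx.
  by apply=> K; rewrite inE fE => /negPf ->.
move=> z z1; rewrite /H (le_trans (cmod_sum _ _ _)) //.
apply: le_trans (_ : \sum_(e : E) (N ^ n)%:R^-1 * M <= _).
  apply: ler_sum => e _; rewrite cmodM ler_pM ?cmod_ge0 //; last first.
    by apply/GM/in_disc; rewrite z1.
  rewrite /wt cmodM !cmodV cmod_nat cmod_prod big1 ?invr1 ?mulr1 // => j _.
  by rewrite cmodX w1 expr1n.
rewrite sumr_const card_ffun !card_ord -(mulr_natl (_ * M)) mulrA mulfV ?mul1r //.
by rewrite pnatr_eq0 expn_eq0 negb_and -lt0n N0.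
Qed.

End Cauchy.

(** * Sufficiency *)

Section Sufficiency.
Context (R : realType).

Lemma mi_norm_axis n (j : 'I_n) k : mi_norm (mi_axis j k) = k.
Proof.
rewrite /mi_norm (bigD1 j) //= big1 => [|i /negPf ij].
  by rewrite addn0 /mi_axis eqxx.
by rewrite /mi_axis ij.
Qed.

Lemma prod_axis1 n (j : 'I_n) (f : 'I_n -> R) :
  \prod_i f i ^+ mi_axis j 1 i = f j.
Proof.
rewrite (bigD1 j) //= big1 => [|i /negPf ij].
  by rewrite /mi_axis eqxx expr1 mulr1.
by rewrite /mi_axis ij expr0.
Qed.

(** Minkowski's inequality. Cauchy-Schwarz comes from 0 <= sum_j (B a_j - A
    b_j)^2 = 2 A B (A B - sum_j a_j b_j), where A and B are the two norms. *)
Lemma sqrt_sum_triangle (n : nat) (a b : 'I_n -> R) :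
  Num.sqrt (\sum_j (a j + b j) ^+ 2) <=
    Num.sqrt (\sum_j a j ^+ 2) + Num.sqrt (\sum_j b j ^+ 2).
Proof.
have s0 (f : 'I_n -> R) : 0 <= \sum_j f j ^+ 2 by apply: sumr_ge0 => j _; exact: sqr_ge0.
set A := Num.sqrt (\sum_j a j ^+ 2); set B := Num.sqrt (\sum_j b j ^+ 2).
have A2 : A ^+ 2 = \sum_j a j ^+ 2 by rewrite sqr_sqrtr ?s0.
have B2 : B ^+ 2 = \sum_j b j ^+ 2 by rewrite sqr_sqrtr ?s0.
have A0 : 0 <= A by exact: sqrtr_ge0.
have B0 : 0 <= B by exact: sqrtr_ge0.
have zero (f : 'I_n -> R) : Num.sqrt (\sum_j f j ^+ 2) = 0 -> forall j, f j = 0.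
  move=> /eqP; rewrite sqrtr_eq0 => f0 j; apply/eqP; rewrite -sqrf_eq0.
  rewrite eq_le sqr_ge0 andbT (le_trans _ f0) // (bigD1 j) //= lerDl.
  by apply: sumr_ge0 => i _; exact: sqr_ge0.
have CS : \sum_j a j * b j <= A * B.
  have : 0 <= \sum_j (B * a j - A * b j) ^+ 2 by exact: s0.
  have -> : \sum_j (B * a j - A * b j) ^+ 2 =
      2 * (A * B) * (A * B - \sum_j a j * b j).
    transitivity (B ^+ 2 * (\sum_j a j ^+ 2) + A ^+ 2 * (\sum_j b j ^+ 2)
        - 2 * (A * B) * \sum_j a j * b j); last by rewrite -A2 -B2; ring.
    rewrite !mulr_sumr -big_split -sumrB; apply: eq_bigr => j _ /=; ring.
  have : 0 <= A * B by exact: mulr_ge0.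
  rewrite le_eqVlt => /orP[/eqP AB0 _|AB0]; last first.
    by rewrite pmulr_rge0 ?subr_ge0 // mulr_gt0.
  rewrite -AB0; move/esym/eqP: AB0; rewrite mulf_eq0 => /orP[]/eqP /zero f0.
    by rewrite big1 // => j _; rewrite f0 mul0r.
  by rewrite big1 // => j _; rewrite f0 mulr0.
rewrite -(@ler_pXn2r _ 2) ?nnegrE ?addr_ge0 ?sqrtr_ge0 // sqr_sqrtr ?s0 //.
have -> : \sum_j (a j + b j) ^+ 2 = A ^+ 2 + B ^+ 2 + 2 * \sum_j a j * b j.
  rewrite A2 B2 mulr_sumr -!big_split; apply: eq_bigr => j _ /=; ring.
have -> : (A + B) ^+ 2 = A ^+ 2 + B ^+ 2 + 2 * (A * B) by ring.
by rewrite lerD2l ler_wpM2l.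
Qed.

Lemma cnorm_triangle n (z w : 'rV[CC R]_n) : cnorm z <= cnorm w + cnorm (z - w).
Proof.
apply: le_trans (sqrt_sum_triangle (fun j => cmod (w 0 j))
  (fun j => cmod ((z - w) 0 j))).
apply: ler_wsqrtr; apply: ler_sum => j _.
rewrite lerXn2r ?nnegrE ?addr_ge0 ?cmod_ge0 //.
rewrite !mxE (_ : cmod (z 0 j) = cmod (w 0 j + (z 0 j - w 0 j))) ?cmodD //.
by congr (cmod _); ring.
Qed.

(** The radii r_j / L_j(z0) are at most kap r_j, where kap is the largest of
    the 1 / L_j(z0) and is less than (1 - |z0|) / beta. The passage through
    kap keeps the inequality strict when |r| = beta. *)
Lemma polydisc_sub_ball n (beta : R) (L : 'I_n -> 'rV[CC R]_n -> R) r z0 z :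
  0 < beta -> (forall j z, unit_ball R n z -> beta / (1 - cnorm z) < L j z) ->
  admissible_radius beta r -> unit_ball R n z0 ->
  closed_polydisc z0 (scaled_radius r L z0) z -> unit_ball R n z.
Proof.
move=> beta0 hL [r0 rb] z0B zP; rewrite /unit_ball /=.
have d0 : 0 < 1 - cnorm z0 by rewrite subr_gt0.
pose kap := \big[Num.max/0]_j (L j z0)^-1.
have L0 j : 0 < L j z0 by apply: lt_trans (hL j z0 z0B); rewrite divr_gt0.
have kap_lt : kap < (1 - cnorm z0) / beta.
  apply/bigmax_ltP; split=> [|j _]; first by rewrite divr_gt0.
  by rewrite -invf_div ltf_pV2 ?posrE ?divr_gt0 // hL.
have kap0 : 0 <= kap by exact: bigmax_ge_id.
have step : cnorm (z - z0) <= kap * euclid_norm r.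
  rewrite /cnorm /euclid_norm -{1}(ger0_norm kap0) -sqrtr_sqr -sqrtrM ?sqr_ge0 //.
  apply: ler_wsqrtr; rewrite mulr_sumr; apply: ler_sum => j _.
  rewrite -exprMn lerXn2r ?nnegrE ?cmod_ge0 ?mulr_ge0 //.
  have := zP j; rewrite !mxE => /le_trans; apply.
  by rewrite mulrC ler_wpM2r // le_bigmax.
rewrite (le_lt_trans (cnorm_triangle z z0)) // -ltrBrDl.
rewrite (le_lt_trans step) // (le_lt_trans (ler_wpM2l kap0 rb)) //.
by rewrite -ltr_pdivlMr.
Qed.

Lemma analytic_series n (F : 'rV[CC R]_n -> CC R) z : analytic_in_ball F ->
  unit_ball R n z -> exists c rho, has_series F z c rho.
Proof.
move=> hF /hF[c [rho [rho0 hc]]]; exists c, rho; split=> // w /hc.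
exact: cvg_sums_to.
Qed.

(** The factorial in [scaled_coef] is the one in Taylor's formula. *)
Lemma scaled_coef_series n (F : 'rV[CC R]_n -> CC R) z c rho L (T : {ffun 'I_n -> nat}) :
  has_series F z c rho ->
  scaled_coef L F T z = cmod (c T) / \prod_j L j z ^+ T j.
Proof.
move=> /mderiv_center Fc; rewrite /scaled_coef Fc cmodM cmod_nat.
have -> : [ffun i => T i] = T by apply/ffunP => i; rewrite ffunE.
rewrite invfM mulrACA mulfV ?mul1r // pnatr_eq0 -lt0n.
by apply: prodn_gt0 => i; exact: fact_gt0.
Qed.

Lemma scaled_coef_ge0 n (F : 'rV[CC R]_n -> CC R) z L (T : 'I_n -> nat) :
  (forall j, 0 < L j z) -> 0 <= scaled_coef L F T z.
Proof.
move=> L0; rewrite divr_ge0 ?cmod_ge0 ?mulr_ge0 ?prodr_ge0 // => j _.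
by rewrite exprn_ge0 // ltW.
Qed.

Lemma le_bigmax_scaled_coef n (F : 'rV[CC R]_n -> CC R) z L (T : 'I_n -> nat) m :
  (mi_norm T <= m)%N ->
  scaled_coef L F T z <=
    \big[Num.max/0]_(K : {ffun 'I_n -> 'I_m.+1} | (mi_norm (fun j => K j) <= m)%N)
       scaled_coef L F (fun j => K j) z.
Proof.
move=> Tm; pose K : {ffun 'I_n -> 'I_m.+1} := [ffun j => inord (T j)].
have KT : (fun j => nat_of_ord (K j)) = T.
  apply/funext => j; rewrite ffunE inordK // ltnS.
  exact: leq_trans (leq_mi_norm _ _) Tm.
have := @le_bigmax_cond _ _ _ 0 K (fun K : {ffun 'I_n -> 'I_m.+1} => (mi_norm (fun j => K j) <= m)%N)
  (fun K => scaled_coef L F (fun j => K j) z).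
by rewrite KT; apply.
Qed.

Lemma bernoulli (q : R) s : 1 <= q -> 1 + s%:R * (q - 1) <= q ^+ s.
Proof.
move=> q1; elim: s => [|s IH]; first by rewrite mul0r addr0 expr0.
have s0 : 0 <= s%:R :> R by [].
have := ler_wpM2r (le_trans ler01 q1) IH.
have := mulr_ge0 s0 (sqr_ge0 (q - 1)).
rewrite [q ^+ s.+1]exprSr -(natr1 s); lra.
Qed.

Lemma pow_unbounded (q p : R) : 1 < q -> 0 <= p -> exists s, p <= q ^+ s.
Proof.
move=> q1 p0; have q0 : 0 < q - 1 by rewrite subr_gt0.
exists (Num.Def.archi_bound (p / (q - 1))).
apply: le_trans (bernoulli _ (ltW q1)).
have := archi_boundP (divr_ge0 p0 (ltW q0)); rewrite ltr_pdivrMr // => /ltW.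
by move=> /le_trans; apply; rewrite lerDr.
Qed.

(** Let T = k e_j + J. Cauchy's inequality for d_j^k F on the polydisc of
    radii q / L_i(z), where this derivative is at most p times its value at z,
    bounds |c_T| (T! / J!) q^|J| / L^J by p k! |c_(k e_j)|. Since T! >= J! k!
    and p <= q^|J|, only |c_T| / L^J <= |c_(k e_j)| is left. *)
Lemma axis_dominates n beta (L : 'I_n -> 'rV[CC R]_n -> R) (F : 'rV[CC R]_n -> CC R)
   (q p : R) z j k (T : {ffun 'I_n -> nat}) :
  0 < beta -> (forall j z, unit_ball R n z -> beta / (1 - cnorm z) < L j z) ->
  analytic_in_ball F -> 1 < q -> admissible_radius beta (const_mx q : 'rV[R]_n) ->
  unit_ball R n z ->
  (polydisc_max (mderiv F (mi_axis j k)) z (scaled_radius (const_mx q) L z)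
         <= (p * cmod (mderiv F (mi_axis j k) z))%:E)%E ->
  (k <= T j)%N -> p <= q ^+ (mi_norm T - k) ->
  scaled_coef L F T z <= scaled_coef L F (mi_axis j k) z.
Proof.
move=> beta0 hL hF q1 qadm zB hmax kT pq.
have L0 i : 0 < L i z.
  by apply: lt_trans (hL i z zB); rewrite divr_gt0 // subr_gt0.
have [c [rho Fc]] := analytic_series hF zB.
pose ax : {ffun 'I_n -> nat} := [ffun i => mi_axis j k i].
have axE : (ax : 'I_n -> nat) = mi_axis j k by apply/funext => i; rewrite ffunE.
rewrite -axE in hmax *.
pose J : {ffun 'I_n -> nat} := [ffun i => (T i - ax i)%N].
have axT i : (ax i <= T i)%N by rewrite ffunE /mi_axis; case: eqP => [->|].
have JT i : (J i + ax i)%N = T i by rewrite ffunE subnK.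
have nJ : mi_norm J = (mi_norm T - k)%N.
  have -> : mi_norm T = (mi_norm J + mi_norm ax)%N.
    by rewrite /mi_norm -big_split; apply: eq_bigr => i _; rewrite -JT.
  by rewrite axE mi_norm_axis addnK.
have Gc := series_mderiv ax Fc.
have Gle w : closed_polydisc z (scaled_radius (const_mx q) L z) w ->
    cmod (mderiv F ax w) <= p * cmod (mderiv F ax z).
  move=> wP; rewrite -lee_fin (le_trans _ hmax) //.
  by apply: ereal_sup_ubound; exists w.
have r0 i : 0 <= scaled_radius (const_mx q) L z 0 i.
  by rewrite !mxE divr_ge0 // ltW // (lt_trans ltr01).
have Gs w : closed_polydisc z (scaled_radius (const_mx q) L z) w ->
    exists c' rho', has_series (mderiv F ax) w c' rho'.
  move=> wP; have wB := polydisc_sub_ball beta0 hL qadm zB wP.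
  have [c' [rho' Fc']] := analytic_series hF wB.
  by eexists; exists rho'; apply: series_mderiv Fc'.
have := cauchy_polydisc J r0 Gc Gs Gle.
have -> : [ffun i => (J i + ax i)%N] = T by apply/ffunP => i; rewrite ffunE JT.
rewrite !(scaled_coef_series _ _ Fc) (mderiv_center _ Fc).
have -> : [ffun i => ax i] = ax by apply/ffunP => i; rewrite ffunE.
have fax : 0 < (mi_fact ax)%:R :> R.
  by rewrite ltr0n; apply: prodn_gt0 => i; exact: fact_gt0.
have ffle : (mi_fact ax)%:R <= (\prod_i (J i + ax i) ^_ (ax i))%:R :> R.
  rewrite ler_nat; apply: leq_prod => i _; rewrite JT -bin_ffact.
  by rewrite leq_pmull // bin_gt0.
have PJ : 0 < \prod_i L i z ^+ J i by apply: prodr_gt0 => i _; rewrite exprn_gt0.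
have Pax : 0 < \prod_i L i z ^+ ax i by apply: prodr_gt0 => i _; rewrite exprn_gt0.
have -> : \prod_i L i z ^+ T i = (\prod_i L i z ^+ J i) * (\prod_i L i z ^+ ax i).
  by rewrite -big_split; apply: eq_bigr => i _ /=; rewrite -exprD JT.
have -> : \prod_i scaled_radius (const_mx q) L z 0 i ^+ J i
    = q ^+ (mi_norm T - k) / \prod_i L i z ^+ J i.
  rewrite -nJ /mi_norm -prodrXr -prodf_div; apply: eq_bigr => i _.
  by rewrite !mxE expr_div_n.
rewrite !cmodM !cmod_nat.
have Q0 : 0 < q ^+ (mi_norm T - k) by rewrite exprn_gt0 // (lt_trans ltr01).
move: (q ^+ _) pq Q0 (\prod_i L i z ^+ J i) (\prod_i L i z ^+ ax i) PJ Pax.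
move=> Q pQ Q0 P1 P2 P10 P20.
move: (\prod_i _)%:R ffle => ff ffle H.
rewrite invfM mulrA ler_pM2r ?invr_gt0 // -(ler_pM2l (mulr_gt0 fax Q0)).
rewrite -mulrA; apply: (@le_trans _ _ (ff * cmod (c T) * (Q / P1))).
  have -> : ff * cmod (c T) * (Q / P1) = ff * (Q * (cmod (c T) / P1)) by ring.
  by rewrite ler_wpM2r // mulr_ge0 ?divr_ge0 ?cmod_ge0 // ltW.
apply: le_trans H _; rewrite mulrCA -mulrA ler_wpM2l ?(ltW fax) //.
by rewrite ler_wpM2r ?cmod_ge0.
Qed.

(** Take r = (q, ..., q) with q = beta / sqrt n > 1, a vector of norm beta. If
    |T| > n N + N + s, some T_j is at least N, hence at least k, and |T| - k
    >= s gives p <= q^(|T| - k); so [axis_dominates] compares T with an axis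
    multi-index of norm at most N. *)
Lemma axis_bounds_imply_bounded_index (n : nat) (hn : (0 < n)%N)
    (beta : R) (hbeta : Num.sqrt n%:R < beta)
    (L : 'I_n -> 'rV[CC R]_n -> R)
    (hL : forall j z, unit_ball R n z -> beta / (1 - cnorm z) < L j z)
    (F : 'rV[CC R]_n -> CC R) (hF : analytic_in_ball F) :
  (forall r : 'rV[R]_n, admissible_radius beta r ->
    exists (n0 : nat) (p : R), 1 <= p /\
    forall z0 : 'rV[CC R]_n, unit_ball R n z0 -> forall j : 'I_n,
    exists k : nat, (k <= n0)%N /\
      (polydisc_max (mderiv F (mi_axis j k)) z0 (scaled_radius r L z0)
         <= (p * cmod (mderiv F (mi_axis j k) z0))%:E)%E) ->
   bounded_L_index L F.
Proof.
move=> H; have n0 : 0 < n%:R :> R by rewrite ltr0n.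
have sn0 : 0 < Num.sqrt n%:R :> R by rewrite sqrtr_gt0.
have beta0 : 0 < beta by apply: lt_trans hbeta.
pose q := beta / Num.sqrt n%:R.
have q1 : 1 < q by rewrite ltr_pdivlMr // mul1r.
have qadm : admissible_radius beta (const_mx q : 'rV[R]_n).
  split=> [j|]; first by rewrite mxE ltW // (lt_trans ltr01).
  rewrite /euclid_norm (eq_bigr (fun=> q ^+ 2)) => [|j _]; last by rewrite mxE.
  rewrite sumr_const card_ord -mulr_natl -(sqr_sqrtr (ltW n0)) -exprMn.
  by rewrite sqrtr_sqr /q mulrC divfK ?gt_eqF // gtr0_norm.
have [N [p [p1 hN]]] := H _ qadm.
have [s ps] := pow_unbounded q1 (le_trans ler01 p1).
exists (n * N + N + s)%N => z zB T0.
have L0 i : 0 < L i z.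
  by apply: lt_trans (hL i z zB); rewrite divr_gt0 // subr_gt0.
pose T : {ffun 'I_n -> nat} := [ffun i => T0 i].
have <- : (T : 'I_n -> nat) = T0 by apply/funext => i; rewrite ffunE.
have [Tm|mT] := leqP (mi_norm T) (n * N + N + s)%N.
  exact: le_bigmax_scaled_coef.
have [j jN] : exists j, (N <= T j)%N.
  apply/existsP; apply: contraTT mT; rewrite negb_exists => /forallP TN.
  rewrite -leqNgt -addnA (leq_trans _ (leq_addr _ _)) //.
  apply: (@leq_trans (\sum_(j < n) N)); last by rewrite sum_nat_const card_ord.
  by apply: leq_sum => j _; have := TN j; rewrite -ltnNge => /ltnW.
have [k [kN hk]] := hN z zB j.
apply: le_trans (axis_dominates beta0 hL hF q1 qadm zB hk _ _) _.
- exact: leq_trans jN.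
- by rewrite (le_trans ps) // ler_weXn2l ?(ltW q1) //; lia.
apply: le_bigmax_scaled_coef.
by rewrite mi_norm_axis; lia.
Qed.

End Sufficiency.

(** * Growth along segments *)

Section Growth.
Context (R : realType).

(** Gronwall's inequality for a function that need not be differentiable, such
    as a maximum of moduli: its upper right derivative is at most C g and it
    has no upward jump. Let psi(t) = (g(0) + e) exp((C + 1) t), and let T be
    the supremum of the times at which g <= psi. Without upward jumps T is one
    of these times, and since psi grows faster than C g there, T < 1 is
    impossible. *)
Lemma growth (g : R -> R) (C : R) : 0 <= C -> 0 <= g 0 ->
  (forall t, 0 <= t <= 1 -> exists d D : R, [/\ 0 < d, 0 <= D &
     forall s, 0 <= s <= d -> g (t + s) <= g t * (1 + C * s) + D * s ^+ 2]) ->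
  (forall t, 0 <= t <= 1 -> exists d D : R, [/\ 0 < d, 0 <= D &
     forall s, 0 <= s <= d -> g t <= g (t - s) + D * s]) ->
  g 1 <= expR (C + 1) * g 0.
Proof.
move=> C0 g0 up down.
suff H (e : R) : 0 < e -> g 1 <= (g 0 + e) * expR (C + 1).
  apply/ler_addgt0Pr => e e0; have E0 := expR_gt0 (C + 1).
  have := H (e / expR (C + 1)); rewrite divr_gt0 // => /(_ isT).
  by rewrite mulrDl divfK ?gt_eqF // mulrC.
move=> e0; pose psi (t : R) := (g 0 + e) * expR ((C + 1) * t).
have ge0 : 0 < g 0 + e by rewrite ltr_wpDl.
have psi_gt0 t : 0 < psi t by rewrite mulr_gt0 // expR_gt0.
have psiD t s : psi (t + s) = psi t * expR ((C + 1) * s).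
  by rewrite /psi mulrDr expRD mulrA.
have psi_le t s : 0 <= s -> psi (t - s) <= psi t.
  move=> s0; rewrite ler_pM2l // ler_expR ler_wpM2l ?addr_ge0 //.
  by rewrite gerBl.
pose S := [set t : R | 0 <= t <= 1 /\ g t <= psi t].
have S0 : S 0.
  by split; rewrite ?lexx ?ler01 // /psi mulr0 expR0 mulr1 lerDl ltW.
have supS : has_sup S by split; [exists 0 | exists 1 => t [/andP[]]].
pose T := sup S.
have T0 : 0 <= T by apply: sup_upper_bound.
have T1 : T <= 1 by apply: ge_sup => [|t [/andP[]]//]; exists 0.
have T01 : 0 <= T <= 1 by rewrite T0.
have gT : g T <= psi T.
  rewrite leNgt; apply/negP => gT; have [d [D [d0 D0 hd]]] := down T T01.
  have D1 : 0 < D + 1 by rewrite ltr_wpDl.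
  have eta0 : 0 < Num.min d ((g T - psi T) / (D + 1)).
    by rewrite lt_min d0 divr_gt0 // subr_gt0.
  have [t [t01 gt] tT] := sup_adherent eta0 supS.
  have tT' : t <= T by apply: sup_upper_bound.
  move: tT; rewrite -/T ltrBlDr -ltrBlDl lt_min => /andP[sd].
  rewrite ltr_pdivlMr // => sD.
  have s0 : 0 <= T - t by rewrite subr_ge0.
  have := hd (T - t); rewrite s0 ltW // => /(_ isT).
  have := psi_le T _ s0; rewrite subKr; nra.
have [TE|T1'] := eqVneq T 1.
  by move: gT; rewrite TE /psi mulr1.
have T1s : 0 < 1 - T by rewrite subr_gt0 lt_neqAle T1'.
have [d [D [d0 D0 hd]]] := up T T01.
have D1 : 0 < D + 1 by rewrite ltr_wpDl.
pose s := Num.min (Num.min d (1 - T)) (psi T / (D + 1)).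
have s0 : 0 < s by rewrite !lt_min d0 T1s divr_gt0.
have := lexx s; rewrite {2}/s !le_min ler_pdivlMr // => /andP[/andP[sd sT] sD].
have : S (T + s).
  split; first by apply/andP; split; lra.
  rewrite psiD; have := hd s; rewrite sd ltW // => /(_ isT)/le_trans; apply.
  apply: (@le_trans _ _ (psi T * (1 + (C + 1) * s))); last first.
    by rewrite ler_pM2l // expR_ge1Dx.
  have h1 : g T * (1 + C * s) <= psi T * (1 + C * s).
    by rewrite ler_wpM2r // addr_ge0 // mulr_ge0 // ltW.
  have h2 : s * (s * (D + 1)) <= s * psi T by rewrite ler_pM2l.
  have := sqr_ge0 s; nra.
move=> /(sup_upper_bound supS); rewrite -/T; lra.
Qed.

(** A is the least lambda_{1,j}(r) and B the largest lambda_{2,j}(r), cut off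
    at 1 so that the powers of 1 / A and B increase with the exponent. *)
Lemma ratio_bounds n (beta : R) (L : 'I_n -> 'rV[CC R]_n -> R) (r : 'rV[R]_n) :
  0 < beta -> class_Q beta L -> admissible_radius beta r ->
  exists A B : R, [/\ 0 < A, A <= 1, 1 <= B & forall z0 z j, unit_ball R n z0 ->
    closed_polydisc z0 (scaled_radius r L z0) z ->
    A * L j z0 <= L j z <= B * L j z0].
Proof.
move=> beta0 [_ hL hlam] radm.
pose A : R := \big[Num.min/1]_j fine (lambda1 L r j).
pose B : R := \big[Num.max/1]_j fine (lambda2 L r j).
have fin j : (lambda1 L r j \is a fin_num /\ lambda2 L r j \is a fin_num)%E.
  have [l1 l12 l2] := hlam r radm j; split.
    rewrite fin_numE; apply/andP; split; apply/eqP => E; move: l1 l12 l2;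
      by rewrite E //= => _ /le_lt_trans h /h; rewrite ltxx.
  rewrite fin_numE; apply/andP; split; apply/eqP => E; move: l1 l12 l2;
    by rewrite E ?ltxx // leeNy_eq => l1 /eqP e; rewrite e in l1.
exists A, B; split=> [|||z0 z j z0B zP].
- apply/bigmin_gtP; split=> // j _; have [f1 _] := fin j.
  by rewrite -lte_fin fineK //; case: (hlam r radm j).
- exact: bigmin_le_id.
- exact: bigmax_ge_id.
have L0 : 0 < L j z0.
  by apply: lt_trans (hL j z0 z0B); rewrite divr_gt0 // subr_gt0.
have [f1 f2] := fin j.
have inR : ratio_set L r j (L j z / L j z0)%:E by exists z0, z.
apply/andP; split.
  rewrite -ler_pdivlMr //; apply: (@le_trans _ _ (fine (lambda1 L r j))); first exact: bigmin_le.
  by rewrite -lee_fin fineK //; exact: ereal_inf_lbound.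
rewrite -ler_pdivrMr //; apply: (@le_trans _ _ (fine (lambda2 L r j))); last exact: le_bigmax.
by rewrite -lee_fin fineK //; exact: ereal_sup_ubound.
Qed.

(** Take the least of the ranges and the sum of the constants. *)
Lemma uniform_scale (I : finType) (P : I -> R -> R -> Prop) :
  (forall i d D d' D', P i d D -> 0 < d' <= d -> D <= D' -> P i d' D') ->
  (forall i, exists d D : R, [/\ 0 < d, 0 <= D & P i d D]) ->
  exists d D : R, [/\ 0 < d, 0 <= D & forall i, P i d D].
Proof.
move=> mono hP.
have /choice[d hd] := hP; have /choice[D hD] := hd.
exists (\big[Num.min/1]_i d i), (\sum_i D i).
have d0 : 0 < \big[Num.min/1]_i d i.
  by apply/bigmin_gtP; split=> // i _; case: (hD i).
split=> // [|i]; first by apply: sumr_ge0 => i _; case: (hD i).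
have [_ _ Pi] := hD i; apply: mono Pi _ _.
  by rewrite d0; exact: bigmin_le.
by rewrite (bigD1 i) //= lerDl sumr_ge0 // => k _; case: (hD k).
Qed.

Lemma mi_norm1 n (K : {ffun 'I_n -> nat}) : mi_norm K = 1%N ->
  exists j, K = [ffun i => mi_axis j 1 i].
Proof.
move=> K1; have [j Kj] : exists j, (0 < K j)%N.
  apply/existsP; apply: contraT; rewrite negb_exists => /forallP K0.
  by move: K1; rewrite /mi_norm big1 // => j _; have := K0 j; rewrite lt0n negbK => /eqP.
exists j; move: K1; rewrite /mi_norm (bigD1 j) //=.
case Kk: (K j) Kj => [//|k] _; rewrite addSn => -[/eqP].
rewrite addn_eq0 sum_nat_eq0 => /andP[/eqP k0 /forallP K0].
apply/ffunP => i; rewrite ffunE /mi_axis; case: eqP => [->|/eqP ij].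
  by rewrite Kk k0.
by have := K0 i; rewrite ij => /eqP.
Qed.

Lemma mi_axis1_inj n : injective (fun j : 'I_n => [ffun i => mi_axis j 1 i]).
Proof.
move=> j j' /ffunP/(_ j); rewrite !ffunE /mi_axis eqxx.
by case: eqP.
Qed.

(** K! sum_j v_j (K_j + 1) c_(K + e_j) is the derivative of F^(K) at y in the
    direction v; writing it with the coefficients of F at y links it with
    derivatives of order |K| + 1. *)
Lemma mderiv_line n (F : 'rV[CC R]_n -> CC R) y c rho (v : 'rV[CC R]_n) (K : 'I_n -> nat) :
  has_series F y c rho ->
  exists d D : R, [/\ 0 < d, 0 <= D & forall w, cmod w <= d ->
    cmod (mderiv F K (y + w *: v) - (mderiv F K y + w * ((mi_fact K)%:R *
      \sum_j v 0 j * (K j).+1%:R * c [ffun i => K i + mi_axis j 1 i]%N)))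
    <= D * cmod w ^+ 2].
Proof.
move=> Fc; have Gc := series_mderiv K Fc.
have [a [ha ja]] := line_jet v 2 Gc.
have a0 := jet_center ja; rewrite scale0r addr0 in a0.
have a1 : a 1%N = (mi_fact K)%:R *
      \sum_j v 0 j * (K j).+1%:R * c [ffun i => K i + mi_axis j 1 i]%N.
  apply: (sums_to_unique (ha 1%N)); set f := fun L => _.
  pose e (j : 'I_n) : {ffun 'I_n -> nat} := [ffun i => mi_axis j 1 i].
  have e1 j : mi_norm (e j) = 1%N.
    rewrite /mi_norm (bigD1 j) //= big1 => [|i /negPf ij].
      by rewrite ffunE /mi_axis eqxx.
    by rewrite ffunE /mi_axis ij.
  have -> : (mi_fact K)%:R *
      (\sum_j v 0 j * (K j).+1%:R * c [ffun i => K i + mi_axis j 1 i]%N)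
      = \sum_(L <- [fset e j | j in 'I_n]%fset) f L.
    rewrite big_imfset /=; last by move=> ? ? _ _; exact: mi_axis1_inj.
    rewrite big_enum /= mulr_sumr; apply: eq_bigr => j _.
    rewrite /f e1 eqxx.
    have -> : [ffun i => (e j i + K i)%N] = [ffun i => (K i + mi_axis j 1 i)%N].
      by apply/ffunP => i; rewrite !ffunE addnC.
    have -> : \prod_i v 0 i ^+ e j i = v 0 j.
      rewrite (bigD1 j) //= big1 => [|i /negPf ij].
        by rewrite ffunE /mi_axis eqxx expr1 mulr1.
      by rewrite ffunE /mi_axis ij expr0.
    have -> : (\prod_i (e j i + K i) ^_ K i = (K j).+1 * mi_fact K)%N.
      rewrite /mi_fact (bigD1 j) //= [in RHS](bigD1 j) //= mulnA; congr (_ * _)%N.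
        rewrite ffunE /mi_axis eqxx add1n -factS.
        by rewrite -(ffact_fact (leqnSn (K j))) subSn // subnn muln1.
      by apply: eq_bigr => i /negPf ij; rewrite ffunE /mi_axis ij add0n ffactnn.
    by rewrite natrM; ring.
  apply: sums_to_finite => L nL; rewrite /f; case: eqP => // /mi_norm1[j Lj].
  by case/negP: nL; apply/imfsetP; exists j.
case: ja => d [D [d0 D0 h]]; exists d, D; split=> // w /h.
by rewrite !big_ord_recl big_ord0 -a0 a1 expr0 expr1 mulr1 addr0 [w * _]mulrC.
Qed.

End Growth.

(** * Necessity *)

Section Necessity.
Context (R : realType).

(** Replacing L by L' divides L^T by at most b^|T|. *)
Lemma scaled_coef_rescale n (L L' : 'I_n -> 'rV[CC R]_n -> R) F (T : 'I_n -> nat)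
    (y : 'rV[CC R]_n) (b : R) N :
  1 <= b -> (forall j, 0 < L j y) -> (forall j, 0 < L' j y) ->
  (forall j, L j y <= b * L' j y) -> (mi_norm T <= N)%N ->
  scaled_coef L' F T y <= b ^+ N * scaled_coef L F T y.
Proof.
move=> b1 L0 L'0 LL' TN; rewrite /scaled_coef.
have b0 : 0 < b by apply: lt_le_trans b1.
have f0 : 0 < (mi_fact T)%:R :> R.
  by rewrite ltr0n; apply: prodn_gt0 => i; exact: fact_gt0.
have P0 : 0 < \prod_j L j y ^+ T j by apply: prodr_gt0 => j _; rewrite exprn_gt0.
have P'0 : 0 < \prod_j L' j y ^+ T j by apply: prodr_gt0 => j _; rewrite exprn_gt0.
rewrite mulrCA ler_wpM2l ?cmod_ge0 // ler_pdivlMr ?mulr_gt0 //.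
rewrite mulrC ler_pdivrMr ?mulr_gt0 // mulrCA ler_pM2l //.
apply: (@le_trans _ _ (b ^+ mi_norm T * \prod_j L' j y ^+ T j)); last first.
  by rewrite ler_pM2r // ler_weXn2l.
rewrite /mi_norm -prodrXr -big_split; apply: ler_prod => j _ /=.
rewrite exprn_ge0 ?(ltW (L0 j)) //= -exprMn lerXn2r ?nnegrE ?(ltW (L0 j)) //.
by rewrite mulr_ge0 // ltW.
Qed.

Lemma cancel_weight (w x y e a b : R) : 0 < w ->
  w * x <= w * y + e -> e <= w * a + w * b -> x <= y + a + b.
Proof. by move=> w0 h1 h2; rewrite -(ler_pM2l w0); lra. Qed.

(** With L0 the weight frozen at z0, let g(t) be the maximum of the scaled
    coefficients of order at most m, relative to L0, at the point z0 + t (z -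
    z0). Bounded index and the comparison of L with L0 on the polydisc bound
    the scaled coefficients of order m + 1 by Q g, so g grows at rate at most
    C g and [growth] gives g(1) <= exp(C + 1) g(0). The multi-index K0 is one
    that realises the maximum g(0). *)
Lemma bounded_index_local_growth (n : nat) (beta : R) (beta0 : 0 < beta)
    (L : 'I_n -> 'rV[CC R]_n -> R) (hL : class_Q beta L)
    (F : 'rV[CC R]_n -> CC R) (hF : analytic_in_ball F) :
  bounded_L_index L F ->
   forall r : 'rV[R]_n, admissible_radius beta r ->
   exists (n0 : nat) (p : R), 1 <= p /\
   forall z0 : 'rV[CC R]_n, unit_ball R n z0 ->
   exists K0 : 'I_n -> nat, (mi_norm K0 <= n0)%N /\
     (polydisc_max (mderiv F K0) z0 (scaled_radius r L z0)
        <= (p * cmod (mderiv F K0 z0))%:E)%E.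
Proof.
move=> [m hm] r radm; have [rge0 _] := radm.
have [A [B [A0 A1 B1 hAB]]] := ratio_bounds beta0 hL radm.
have [_ hLb _] := hL.
pose Q := B ^+ m.+1 * A^-1 ^+ m.
have B0 : 0 < B by apply: lt_le_trans B1.
have Q0 : 0 <= Q by apply: mulr_ge0; apply: exprn_ge0; rewrite ?invr_ge0 ltW.
pose C := Q * m.+1%:R * \sum_j r 0 j.
have C0 : 0 <= C by apply: mulr_ge0; [apply: mulr_ge0 | apply: sumr_ge0 => j _].
exists m, (expR (C + 1)); split.
  by apply: le_trans (expR_ge1Dx _); rewrite lerDl addr_ge0.
move=> z0 z0B.
have Lpos j y : unit_ball R n y -> 0 < L j y.
  by move=> yB; apply: lt_trans (hLb j y yB); rewrite divr_gt0 // subr_gt0.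
pose L0 j (_ : 'rV[CC R]_n) := L j z0.
have L0pos j y : 0 < L0 j y by exact: Lpos.
pose maxc y := \big[Num.max/0]_(K : {ffun 'I_n -> 'I_m.+1} |
   (mi_norm (fun j => K j) <= m)%N) scaled_coef L0 F (fun j => K j) y.
have maxc_ge0 y : 0 <= maxc y by exact: bigmax_ge_id.
pose w (K : 'I_n -> nat) : R := (mi_fact K)%:R * \prod_j L j z0 ^+ K j.
have w0 K : 0 < w K.
  rewrite mulr_gt0 ?ltr0n ?prodn_gt0 // => [i|]; first exact: fact_gt0.
  by apply: prodr_gt0 => j _; rewrite exprn_gt0 // Lpos.
have scE K y : cmod (mderiv F K y) = w K * scaled_coef L0 F K y.
  by rewrite /scaled_coef mulrC divfK // gt_eqF // w0.
have [K0 K0m K0E] : {K0 : {ffun 'I_n -> 'I_m.+1} | (mi_norm (fun j => K0 j) <= m)%N &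
    maxc z0 = scaled_coef L0 F (fun j => K0 j) z0}.
  apply: (eq_bigmax [ffun=> ord0]) => [|K _]; last exact: scaled_coef_ge0.
  by rewrite /mi_norm big1 // => j _; rewrite ffunE.
exists (fun j => K0 j); split=> //.
suff key z : closed_polydisc z0 (scaled_radius r L z0) z ->
    maxc z <= expR (C + 1) * maxc z0.
  apply: ge_ereal_sup => _ [z zP <-]; rewrite lee_fin !scE [leRHS]mulrCA.
  rewrite ler_pM2l ?w0 // -K0E (le_trans _ (key z zP)) //.
  exact: le_bigmax_scaled_coef.
(* Bounded index at y itself, after a change from L0 to L and before a change
   back. *)
have next y T : closed_polydisc z0 (scaled_radius r L z0) y -> (mi_norm T <= m.+1)%N ->
    scaled_coef L0 F T y <= Q * maxc y.
  move=> yP Tm; have yB := polydisc_sub_ball beta0 hLb radm z0B yP.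
  have yAB j := hAB z0 y j z0B yP.
  apply: (@le_trans _ _ (B ^+ m.+1 * scaled_coef L F T y)).
    apply: scaled_coef_rescale => // j; first exact: Lpos.
    by case/andP: (yAB j).
  rewrite -mulrA ler_wpM2l ?exprn_ge0 ?(ltW B0) // (le_trans (hm y yB T)) //.
  apply/bigmax_leP; split=> [|K Km].
    by apply: mulr_ge0 => //; apply: exprn_ge0; rewrite invr_ge0 ltW.
  apply: (@le_trans _ _ (A^-1 ^+ m * scaled_coef L0 F (fun j => K j) y)).
    apply: scaled_coef_rescale => // [|j|j]; first by rewrite invf_ge1.
      exact: Lpos.
    by rewrite mulrC ler_pdivlMr // mulrC; case/andP: (yAB j).
  rewrite ler_wpM2l ?exprn_ge0 ?invr_ge0 ?(ltW A0) //.
  exact: le_bigmax_scaled_coef.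
move=> zP; pose v := z - z0; pose y (t : R) := z0 + t%:C *: v.
have vle j : cmod (v 0 j) * L j z0 <= r 0 j.
  have := zP j; rewrite /scaled_radius mxE ler_pdivlMr ?Lpos //.
  by rewrite /v !mxE.
have yP t : 0 <= t <= 1 -> closed_polydisc z0 (scaled_radius r L z0) (y t).
  move=> /andP[t0 t1] j; rewrite /y /v !mxE [z0 0 j + _]addrC addrK cmodM.
  rewrite cmod_real ger0_norm // ler_pdivlMr ?Lpos // -mulrA.
  have := vle j; rewrite /v !mxE => vlej.
  apply: le_trans (ler_wpM2l t0 vlej) _.
  by rewrite ler_piMl.
have yD t s : y (t + s) = y t + s%:C *: v.
  by rewrite /y rmorphD scalerDl addrA.
pose g t := maxc (y t).
have y0 : y 0 = z0 by rewrite /y rmorph0 scale0r addr0.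
have y1 : y 1 = z by rewrite /y rmorph1 scale1r addrC subrK.
(* The rate of change of each scaled coefficient is at most C g, in both directions. *)
have expand t : 0 <= t <= 1 -> exists d D : R, [/\ 0 < d, 0 <= D &
    forall K : {ffun 'I_n -> 'I_m.+1}, (mi_norm (fun j => K j) <= m)%N ->
    forall s, `|s| <= d ->
      scaled_coef L0 F (fun j => K j) (y (t + s)) <= scaled_coef L0 F (fun j => K j) (y t)
         + `|s| * (C * g t) + D * s ^+ 2 /\
      scaled_coef L0 F (fun j => K j) (y t) <= scaled_coef L0 F (fun j => K j) (y (t + s))
         + `|s| * (C * g t) + D * s ^+ 2].
  move=> t01; have yB := polydisc_sub_ball beta0 hLb radm z0B (yP t t01).
  have [c [rho Fc]] := analytic_series hF yB.
  have step (K : {ffun 'I_n -> 'I_m.+1}) : exists d D : R, [/\ 0 < d, 0 <= D &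
      (mi_norm (fun j => K j) <= m)%N -> forall s, `|s| <= d ->
      cmod (mderiv F (fun j => K j) (y (t + s)) - mderiv F (fun j => K j) (y t))
      <= w (fun j => K j) * (`|s| * (C * g t)) + w (fun j => K j) * (D * s ^+ 2)].
    pose K' : 'I_n -> nat := fun j => K j; rewrite -/K'.
    have [d [D [d0 D0 hd]]] := mderiv_line v K' Fc.
    exists d, (D / w K'); split=> //; first by rewrite divr_ge0 // ltW // w0.
    move=> Km s sd.
    set a1 := (mi_fact K')%:R * _ in hd.
    have a1_le : cmod a1 <= w K' * (C * g t).
      pose P := \prod_i L i z0 ^+ K' i.
      have P0 : 0 < P by apply: prodr_gt0 => i _; rewrite exprn_gt0 // Lpos.
      have -> : w K' * (C * g t) =
          (mi_fact K')%:R * \sum_j (P * (Q * m.+1%:R * g t) * r 0 j).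
        by rewrite -mulr_sumr /w /C -/P; ring.
      rewrite /a1 cmodM cmod_nat ler_wpM2l //.
      rewrite (le_trans (cmod_sum _ _ _)) //; apply: ler_sum => j _.
      set T : {ffun 'I_n -> nat} := [ffun i => _].
      have Tm : (mi_norm T <= m.+1)%N.
        have -> : mi_norm T = (mi_norm K' + mi_norm (mi_axis j 1))%N.
          by rewrite /mi_norm -big_split; apply: eq_bigr => i _; rewrite ffunE.
        by rewrite mi_norm_axis addn1.
      have := next _ T (yP t t01) Tm; rewrite (scaled_coef_series _ _ Fc) -/(g t).
      have -> : \prod_i L0 i (y t) ^+ T i = L j z0 * P.
        rewrite mulrC -{1}(prod_axis1 j (fun i => L i z0)) -big_split.
        by apply: eq_bigr => i _; rewrite ffunE exprD.
      rewrite ler_pdivrMr ?mulr_gt0 ?Lpos // => cT.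
      rewrite !cmodM cmod_nat.
      have k0 : 0 <= cmod (v 0 j) * (K' j).+1%:R by rewrite mulr_ge0 ?cmod_ge0.
      rewrite (le_trans (ler_wpM2l k0 cT)) //.
      have -> : cmod (v 0 j) * (K' j).+1%:R * (Q * g t * (L j z0 * P))
        = (P * (Q * g t)) * ((cmod (v 0 j) * L j z0) * (K' j).+1%:R) by ring.
      have -> : P * (Q * m.+1%:R * g t) * r 0 j =
        (P * (Q * g t)) * (r 0 j * m.+1%:R) by ring.
      have gt0 : 0 <= g t by exact: maxc_ge0.
      have PQg : 0 <= P * (Q * g t) by apply: mulr_ge0; [exact: ltW|exact: mulr_ge0].
      rewrite (ler_wpM2l PQg) // ler_pM ?mulr_ge0 ?cmod_ge0 ?(ltW (Lpos _ _ z0B)) //.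
      by rewrite ler_nat ltn_ord.
    have := hd s%:C; rewrite cmod_real => /(_ sd); rewrite -yD => h.
    set f' := mderiv F K' (y (t + s)) in h *.
    set f := mderiv F K' (y t) in h *.
    rewrite (_ : f' - f = s%:C * a1 + (f' - (f + s%:C * a1))); last by ring.
    rewrite (le_trans (cmodD _ _)) // lerD //.
      by rewrite cmodM cmod_real mulrCA ler_wpM2l.
    rewrite (le_trans h) // real_normK ?num_real //.
    by rewrite mulrA [w K' * (D / _)]mulrC divfK // gt_eqF // w0.
  have [|d [D [d0 D0 hd]]] := uniform_scale _ step.
    move=> K d D d' D' h /andP[d'0 d'd] DD' Km s sd'.
    apply: le_trans (h Km s (le_trans sd' d'd)) _.
    by rewrite lerD2l ler_wpM2l ?(ltW (w0 _)) // ler_wpM2r ?sqr_ge0.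
  exists d, D; split=> // K Km s sd; pose K' : 'I_n -> nat := fun j => K j.
  pose f' := mderiv F K' (y (t + s)); pose f := mderiv F K' (y t).
  have e1 : cmod f' = w K' * scaled_coef L0 F K' (y (t + s)) by exact: scE.
  have e2 : cmod f = w K' * scaled_coef L0 F K' (y t) by exact: scE.
  have h : cmod (f' - f) <= w K' * (`|s| * (C * g t)) + w K' * (D * s ^+ 2).
    exact: hd.
  move: f' f e1 e2 h => f' f e1 e2 h.
  have t1 : cmod f' <= cmod f + cmod (f' - f).
    by rewrite -{1}(subrK f f') addrC; exact: cmodD.
  have t2 : cmod f <= cmod f' + cmod (f' - f).
    by rewrite -{1}(subKr f' f); exact: cmodB.
  rewrite e1 e2 in t1 t2.
  by split; [exact: cancel_weight (w0 K') t1 h | exact: cancel_weight (w0 K') t2 h].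
have -> : maxc z = g 1 by rewrite /g y1.
have -> : maxc z0 = g 0 by rewrite /g y0.
apply: (growth C0 (maxc_ge0 _)) => t t01.
- have [d [D [d0 D0 hd]]] := expand t t01; exists d, D; split=> // s /andP[s0 sd].
  apply/bigmax_leP; split=> [|K Km].
    have s2 := mulr_ge0 D0 (sqr_ge0 s).
    have gC := mulr_ge0 (maxc_ge0 (y t)) (mulr_ge0 C0 s0).
    have := maxc_ge0 (y t); rewrite -/(g t) in gC *; lra.
  have [|+ _] := hd _ Km s; first by rewrite ger0_norm.
  move=> /le_trans; apply; rewrite ger0_norm // lerD2r mulrDr mulr1.
  rewrite [g t * _]mulrC [C * s]mulrC -!mulrA lerD2r.
  exact: le_bigmax_scaled_coef.
- have [d [D [d0 D0 hd]]] := expand t t01.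
  have gt0 : 0 <= g t by exact: maxc_ge0.
  have D'0 : 0 <= C * g t + D * d.
    by apply: addr_ge0; apply: mulr_ge0 => //; exact: ltW.
  exists d, (C * g t + D * d); split=> // s /andP[s0 sd].
  apply/bigmax_leP; split=> [|K Km].
    by apply: addr_ge0; [exact: maxc_ge0 | exact: mulr_ge0].
  have [|_ +] := hd _ Km (- s); first by rewrite normrN ger0_norm.
  rewrite normrN sqrrN ger0_norm // -addrA => h; apply: le_trans h _.
  apply: lerD; first exact: le_bigmax_scaled_coef.
  have := ler_wpM2l (mulr_ge0 D0 s0) sd; lra.
Qed.

End Necessity.

Theorem theorem2 (R : realType) (n : nat) (hn : (0 < n)%N)
    (beta : R) (hbeta : Num.sqrt n%:R < beta)
    (L : 'I_n -> 'rV[CC R]_n -> R) (hL : class_Q beta L)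
    (F : 'rV[CC R]_n -> CC R) (hF : analytic_in_ball F) :
  (bounded_L_index L F ->
   forall r : 'rV[R]_n, admissible_radius beta r ->
   exists (n0 : nat) (p : R), 1 <= p /\
   forall z0 : 'rV[CC R]_n, unit_ball R n z0 ->
   exists K0 : 'I_n -> nat, (mi_norm K0 <= n0)%N /\
     (polydisc_max (mderiv F K0) z0 (scaled_radius r L z0)
        <= (p * cmod (mderiv F K0 z0))%:E)%E)
  /\
  ((forall r : 'rV[R]_n, admissible_radius beta r ->
    exists (n0 : nat) (p : R), 1 <= p /\
    forall z0 : 'rV[CC R]_n, unit_ball R n z0 -> forall j : 'I_n,
    exists k : nat, (k <= n0)%N /\
      (polydisc_max (mderiv F (mi_axis j k)) z0 (scaled_radius r L z0)
         <= (p * cmod (mderiv F (mi_axis j k) z0))%:E)%E) ->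
   bounded_L_index L F).
Proof.
have beta0 : 0 < beta by apply: le_lt_trans hbeta; exact: sqrtr_ge0.
have [_ hLb _] := hL.
split; first by apply: (bounded_index_local_growth beta0 hL hF).
by apply: (axis_bounds_imply_bounded_index hn hbeta hLb hF).
Qed.
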